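(* Let $k$ be a nonnegative integer. Every finite simple graph $G$ having at most $k$ vertices of degree less than three and having at least $5k^2$ vertices contains two cycles whose lengths differ by one or two.
   Context: Graphs are finite and simple. The degree of a vertex is the number of edges incident to it. A cycle is a subgraph forming a closed path with at least three distinct vertices; its length is its number of edges. The two cycles are distinct cycles of $G$ with $|\,|C_1|-|C_2|\,|\in\{1,2\}$. *)

(* Defs.v *)
From mathcomp Require Import all_boot all_order all_algebra.

Set Implicit Arguments.
Unset Strict Implicit.
Unset Printing Implicit Defensive.

(* A finite simple graph is a finType V with a symmetric irreflexive
   adjacency relation e : rel V. *)
Section Graph.
Variables (V : finType) (e : rel V).

Definition simple_graph : Prop := symmetric e /\ irreflexive e.

Definition edges : {set {set V}} :=
  [set [set p.1; p.2] | p : V * V & e p.1 p.2].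

Definition degree (v : V) : nat := #|[set E in edges | v \in E]|.

(* A cycle subgraph is given by listing its vertices in cyclic order; the
   starting point and the direction of the list are immaterial, and the
   subgraph is determined by cycle_edges. *)
Definition is_cycle (c : seq V) : bool := (2 < size c) && ucycleb e c.

Definition cycle_edges (c : seq V) : {set {set V}} :=
  [set [set x; next c x] | x in c].

Definition cycle_length (c : seq V) : nat := #|cycle_edges c|.

Lemma degreeE (v : V) :
  simple_graph -> degree v = #|[set w | e v w]|.
Proof.
move=> [e_sym eirr]; rewrite /degree.
have inj : {in [set w | e v w] &, injective (fun w => [set v; w])}.
  move=> w w'; rewrite !inE => evw evw' /setP/(_ w); rewrite !inE eqxx orbT.
  move/esym/orP=> [/eqP wv|/eqP//]; by rewrite wv eirr in evw.
rewrite -(card_in_imset inj); apply: eq_card => E; rewrite inE.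
apply/andP/imsetP => [[/imsetP[[x y]]]|[w]]; rewrite !inE /=.
  move=> exy ->; rewrite !inE => /orP[]/eqP->.
    by exists y; rewrite ?inE.
  by exists x; rewrite ?inE 1?e_sym // setUC.
move=> evw ->; split; last by rewrite !inE eqxx.
by apply/imsetP; exists (v, w); rewrite ?inE.
Qed.

Lemma cycle_lengthE (c : seq V) : is_cycle c -> cycle_length c = size c.
Proof.
move=> /andP[c3 /andP[_ cu]]; rewrite /cycle_length /cycle_edges.
rewrite card_in_imset; first exact/card_uniqP.
have nn z : z \in c -> next c (next c z) != z.
  move=> /rot_to[i s cE].
  have cu' : uniq (z :: s) by rewrite -cE rot_uniq.
  have c3' : 2 < size (z :: s) by rewrite -cE size_rot.
  rewrite -!(next_rot i cu) cE.
  case: s cu' c3' {cE} => [|a [|b s]] //= /andP[].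
  rewrite !inE !negb_or => /and3P[za zb _] _ _.
  rewrite eqxx; rewrite eq_sym in za; rewrite (negbTE za) eqxx.
  by rewrite eq_sym.
move=> x y xc yc /setP E.
have := E x; rewrite !inE eqxx /= => /esym/orP[/eqP//|/eqP xy].
have := E y; rewrite !inE eqxx /= => /orP[/eqP//|/eqP yx].
by move: (nn _ yc); rewrite -xy -yx eqxx.
Qed.

End Graph.

(* Main.v *)
(* Call a graph bad if no two of its cycles differ in length by one or two.
   By induction over induced subgraphs, a bad graph with k vertices of degree
   less than three has at most a quadratic number of vertices, and none at all
   if its deficiency, the sum of (3 - deg v)^+, is at most two (the theorem of
   Bondy and Vince).  Vertices of degree at most one are deleted, and a graph
   with a cut vertex is split there.  In a 2-connected bad graph choose a cycle
   C and a connected subgraph B disjoint from C with B maximal.  The set A of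
   vertices adjacent to B lies on every cycle avoiding B.  Two vertices of A
   that are nearly antipodal on C would give two cycles through B with nearly
   equal lengths, so A is at most half of C; and outside B the graph is so close
   to a forest that it has at most linearly many vertices, in terms of the
   low-degree vertices it contains.  Hence B together with the vertices of A
   having two neighbours in B has deficiency no larger than that of the whole
   graph.  If it is smaller, induction applies.  If it is equal, C alternates
   between A and F = C \ A; then either an ear of length at most four joins two
   vertices of F and rerouting through it and B gives two cycles of nearly equal
   length, or F consists of vertices of degree two.  The last case is excluded
   by running the argument relative to a maximal "core" T of vertices of degree
   two and choosing C to avoid T and part of its neighbourhood: F could be added
   to T. *)
Require Import Defs.
From mathcomp Require Import all_boot all_order all_algebra zify.

Set Implicit Arguments.
Unset Strict Implicit.
Unset Printing Implicit Defensive.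

Section Graph.
Variables (V : finType) (e : rel V).
Hypotheses (e_sym : symmetric e) (e_irr : irreflexive e).
Implicit Types (S T U X Y Z B W : {set V}) (x y z v : V) (p q r c : seq V).

(** * Degrees into a vertex set *)

Definition deg_in S v := \sum_(w in S) (e v w : nat).

Lemma deg_inE S v : deg_in S v = #|[set w in S | e v w]|.
Proof.
rewrite /deg_in -sum1_card; under [RHS]eq_bigl do rewrite inE.
by rewrite big_mkcondr /=; apply: eq_bigr => w _; case: (e v w).
Qed.

Lemma deg_in_gt0P S v : reflect (exists2 w, w \in S & e v w) (0 < deg_in S v).
Proof.
rewrite deg_inE; apply: (iffP card_gt0P) => [[w]|[w wS evw]].
  by rewrite inE => /andP[]; exists w.
by exists w; rewrite inE wS.
Qed.

Lemma deg_in_gt1P S v :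
  reflect (exists w1 w2, [/\ w1 != w2, w1 \in S, w2 \in S, e v w1 & e v w2])
          (1 < deg_in S v).
Proof.
rewrite deg_inE; apply: (iffP card_gt1P) => [[x [y []]]|[x [y [xy xS yS ex ey]]]].
  by rewrite !inE => /andP[xS ex] /andP[yS ey] xy; exists x, y.
by exists x, y; rewrite !inE xS yS ex ey.
Qed.

Lemma deg_in_sub S W v : S \subset W -> deg_in S v <= deg_in W v.
Proof.
move=> /subsetP sub; rewrite !deg_inE; apply: subset_leq_card.
by apply/subsetP=> w; rewrite !inE => /andP[/sub -> ->].
Qed.

Lemma sum_deg_in S X :
  \sum_(x in S) deg_in X x = \sum_(y in X) deg_in S y.
Proof.
rewrite exchange_big /=; apply: eq_bigr => y _; apply: eq_bigr => x _.
by rewrite e_sym.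
Qed.

Lemma deg_inID X S v : deg_in S v = deg_in (S :&: X) v + deg_in (S :\: X) v.
Proof. exact: big_setID. Qed.

Lemma deg_inU X Y v : [disjoint X & Y] ->
  deg_in (X :|: Y) v = deg_in X v + deg_in Y v.
Proof.
by move=> dXY; rewrite /deg_in -bigU //=; apply: eq_bigl => x; rewrite !inE.
Qed.

Lemma deg_inD1 S u v : u \in S -> deg_in S v = e v u + deg_in (S :\ u) v.
Proof. by move=> uS; rewrite /deg_in (big_setD1 u). Qed.

Lemma deg_in0 S v : (forall w, w \in S -> e v w = false) -> deg_in S v = 0.
Proof. by move=> h; apply: big1 => w /h->. Qed.

(* The bound proved below is quadratic in [low_count] but only linear in
   [shortfall]: a bound quadratic in [defect] alone would exceed 5k^2. *)
Definition defect S := \sum_(v in S) (3 - deg_in S v).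
Definition low_count S := \sum_(v in S) (deg_in S v < 3).
Definition shortfall S := \sum_(v in S) (2 - deg_in S v).

Lemma defectE S : defect S = low_count S + shortfall S.
Proof.
rewrite /defect -big_split /=; apply: eq_bigr => v _.
by case: (deg_in S v) => [|[|[|n]]].
Qed.

Lemma shortfall_le S : shortfall S <= 2 * low_count S.
Proof.
rewrite big_distrr /=; apply: leq_sum => v _.
by case: (deg_in S v) => [|[|[|n]]].
Qed.

(** * Cycles and forests *)

Definition cyc c := (2 < size c) && (cycle e c && uniq c).

Definition acyclic W := forall c, cyc c -> {subset c <= W} -> False.

Lemma cyc_rot n c : cyc (rot n c) = cyc c.
Proof. by rewrite /cyc size_rot rot_cycle rot_uniq. Qed.

(** At [x] the path can no longer be extended. Of two neighbours of [x] on [p], one is not the first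
    vertex of [p], and closing up there gives at least three vertices. *)
Lemma closing_path W x p : path e x p -> uniq (x :: p) ->
  {subset x :: p <= W} -> (forall z, z \in W -> e z x -> z \in p) ->
  1 < deg_in W x -> exists2 c, cyc c & {subset c <= W}.
Proof.
move=> px up sub ext /deg_in_gt1P[y [z [yz yW zW xy xz]]].
have yp : y \in p by apply: ext => //; rewrite e_sym.
have zp : z \in p by apply: ext => //; rewrite e_sym.
suff [w [wp exw w1]] : exists w, [/\ w \in p, e x w & 0 < index w p].
  case/splitPr def_p: {1}p / (wp) => [p1 p2].
  have p1E : size p1 = index w p.
    rewrite def_p index_cat /= eqxx addn0.
    move: up; rewrite def_p /= cat_uniq /= => /and3P[_ _ /andP[+ _]].
    by rewrite negb_or => /andP[/negbTE->].
  exists (x :: p1 ++ [:: w]); last first.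
    move=> v vp; apply: sub; move: vp; rewrite def_p !inE !mem_cat !inE.
    by case/or3P=> [-> | -> | ->]; rewrite ?orbT.
  apply/and3P; split.
  - by rewrite /= size_cat /= p1E addn1 !ltnS.
  - rewrite /= -cats1 -catA; move: px; rewrite def_p !cat_path /=.
    by move=> /and3P[-> -> _]; rewrite e_sym exw.
  - apply: subseq_uniq up; rewrite def_p /= eqxx.
    by rewrite cat_subseq //= eqxx sub0seq.
have [i0|] := posnP (index y p); last by exists y.
exists z; split=> //; rewrite lt0n; apply: contra yz => /eqP i0'.
by rewrite -(nth_index x yp) -(nth_index x zp) i0 i0'.
Qed.

Lemma min_deg2_cycle W : W != set0 -> {in W, forall w, 1 < deg_in W w} ->
  exists2 c, cyc c & {subset c <= W}.
Proof.
move=> /set0Pn[w0 w0W] degW.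
(* A path on more than [#|V|] vertices is impossible, so the extension at the head must get
   stuck. *)
suff grow n : (exists2 c, cyc c & {subset c <= W}) \/
    exists x p, [/\ size p = n, path e x p, uniq (x :: p) & {subset x :: p <= W}].
  case: (grow #|V|) => // -[x [p [sp _ up _]]].
  by have := max_card (mem (x :: p)); rewrite (card_uniqP up) /= sp ltnn.
elim: n => [|n [|[x [p [sp px up sub]]]]]; last 2 first.
- by left.
- case: (boolP [exists z in W, e z x && (z \notin p)]) => [/existsP[z]|none].
    case/and3P=> zW ezx zp; right; exists z, (x :: p); split=> //=.
    + by rewrite sp.
    + by rewrite ezx.
    + rewrite inE negb_or zp andbT -[(x \notin p) && _]/(uniq (x :: p)) up andbT.
      by apply: contraTneq ezx => ->; rewrite e_irr.
    + by move=> v; rewrite in_cons => /predU1P[->|/sub].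
  have xW : x \in W by apply: sub; rewrite mem_head.
  left; apply: (closing_path px up sub) (degW x xW) => z zW ezx.
  case: (boolP (z \in p)) => // zp.
  by case/negP: none; apply/existsP; exists z; rewrite zW ezx zp.
by right; exists w0, [::]; split=> // v; rewrite inE => /eqP->.
Qed.

Lemma acyclic_sub X W : X \subset W -> acyclic W -> acyclic X.
Proof. by move=> /subsetP sub acW c cc cX; apply: (acW c cc) => x /cX /sub. Qed.

Lemma sum_deg_inD1 W w : w \in W -> \sum_(v in W) deg_in W v =
  2 * deg_in W w + \sum_(v in W :\ w) deg_in (W :\ w) v.
Proof.
move=> wW; rewrite (big_setD1 w wW) /=.
under eq_bigr => v do rewrite (deg_inD1 _ wW).
rewrite big_split /= (_ : \sum_(v in W :\ w) _ = deg_in W w); first lia.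
rewrite (deg_inD1 _ wW) e_irr add0n; apply: eq_bigr => v _.
by rewrite e_sym.
Qed.

(** A forest on n > 0 vertices has at most n - 1 edges; the induction deletes a vertex of degree at
    most one, which exists by [min_deg2_cycle]. *)
Lemma acyclic_deg_sum W : acyclic W -> W != set0 ->
  \sum_(w in W) deg_in W w + 2 <= 2 * #|W|.
Proof.
have [n] := ubnP #|W|; elim: n W => // n IHn W leWn acW W0.
have [w wW degw] : exists2 w, w \in W & deg_in W w <= 1.
  case: (boolP [exists w in W, deg_in W w <= 1]) => [/exists_inP//|none].
  have [|c cc cW] := min_deg2_cycle W0; last by case: (acW c cc cW).
  move=> w wW; rewrite ltnNge; apply: contra none => dw.
  by apply/exists_inP; exists w.
have cW : #|W| = #|W :\ w|.+1 by rewrite (cardsD1 w) wW.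
have sumE := sum_deg_inD1 wW.
have [Ww0|Ww0] := eqVneq (W :\ w) set0.
  have : deg_in W w = 0 by rewrite (deg_inD1 _ wW) e_irr Ww0 /deg_in big_set0.
  by rewrite sumE cW Ww0 big_set0 cards0 => ->.
have := IHn (W :\ w) _ _ Ww0; rewrite sumE cW.
have -> : #|W :\ w| < n by lia.
move=> /(_ isT (acyclic_sub (subD1set _ _) acW)); lia.
Qed.

(** * Connected sets and paths through them *)

Definition edge_in B := [rel x y | [&& x \in B, y \in B & e x y]].
Definition connected B := {in B &, forall x y, connect (edge_in B) x y}.

Lemma edge_in_sym B : symmetric (edge_in B).
Proof. by move=> x y /=; rewrite e_sym andbCA. Qed.

Lemma connected1 x : connected [set x].
Proof. by move=> y z /set1P-> /set1P->; apply: connect0. Qed.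

Lemma connected_setU1 B a : connected B -> 0 < deg_in B a -> connected (a |: B).
Proof.
move=> conB /deg_in_gt0P[b bB eab].
have sub x y : connect (edge_in B) x y -> connect (edge_in (a |: B)) x y.
  apply: connect_sub => u v /and3P[uB vB euv]; apply: connect1.
  by rewrite /= !inE uB vB euv !orbT.
have toa x : x \in a |: B -> connect (edge_in (a |: B)) a x.
  case/setU1P=> [->|xB]; first exact: connect0.
  apply: connect_trans (sub _ _ (conB _ _ bB xB)); apply: connect1.
  by rewrite /= !inE eqxx bB eab orbT.
move=> x y xB yB; apply: connect_trans (toa _ yB).
by rewrite (sym_connect_sym (edge_in_sym _)) toa.
Qed.

(* [p] is the interior of a path joining [x] to [y] through [B]. *)
Definition link B x p y :=
  [/\ p != [::], path e x (rcons p y), uniq p & {subset p <= B}].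

Lemma connected_link B x y : connected B -> 0 < deg_in B x -> 0 < deg_in B y ->
  exists p, link B x p y.
Proof.
move=> conB /deg_in_gt0P[b bB exb] /deg_in_gt0P[b' b'B eyb'].
have /connectP[p0 p0b b'E] := conB _ _ bB b'B; move: eyb'; rewrite b'E.
case: (shortenP p0b) => p pb up _ elast.
exists (b :: p); split=> //.
  rewrite rcons_cons /= exb rcons_path e_sym elast andbT.
  by apply: sub_path pb => u v /and3P[].
move=> z; rewrite inE => /predU1P[->//|]; apply/allP: z.
elim: p b {bB exb up elast p0b b'E} pb => //= u p IHp b /andP[/and3P[_ -> _]].
exact: IHp.
Qed.

(** * Attachments of a connected set to a cycle *)

Hypothesis no_near_cycles : forall c1 c2, cyc c1 -> cyc c2 ->
  size c2 \notin [:: (size c1).+1; (size c1).+2].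

(** At least one of the truncated differences is zero, so their sum is the absolute difference of
    the lengths. *)
Lemma cyc_gap c1 c2 : cyc c1 -> cyc c2 ->
  ~~ (0 < (size c1 - size c2) + (size c2 - size c1) < 3).
Proof.
move=> cc1 cc2; have := no_near_cycles cc1 cc2; have := no_near_cycles cc2 cc1.
rewrite !inE; lia.
Qed.

(** Stated by counts so that [uniq] of a concatenation passes to rearrangements and reversals of its
    pieces by linear arithmetic. *)
Lemma uniq_countP (I : eqType) (s : seq I) :
  reflect (forall a, count_mem a s <= 1) (uniq s).
Proof.
apply: (iffP idP) => [us a|]; first by rewrite count_uniq_mem //; case: (a \in s).
elim: s => //= a s IHs cnt; rewrite IHs => [|b]; last first.
  by apply: leq_trans (cnt b); apply: leq_addl.
by rewrite andbT -has_pred1 has_count; have := cnt a; rewrite eqxx; lia.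
Qed.

Ltac uniq_by_count h := let z := fresh "z" in
  apply/uniq_countP => z; move/uniq_countP/(_ z): h; clear;
  rewrite /= ?count_cat /= ?count_cat /= ?count_cat /= ?count_rev; lia.

Lemma two_path_cyc x p y q : path e x (rcons p y) -> path e y (rcons q x) ->
  uniq (x :: p ++ y :: q) -> 0 < size p + size q -> cyc (x :: p ++ y :: q).
Proof.
move=> xpy yqx u pq0; apply/and3P; split=> //.
  by rewrite /= size_cat /=; lia.
by rewrite /= -cat_rcons rcons_cat cat_path last_rcons xpy.
Qed.

Lemma cyc_two_path x p y q : cyc (x :: p ++ y :: q) ->
  [/\ path e x (rcons p y), path e y (rcons q x) & uniq (x :: p ++ y :: q)].
Proof.
move=> /and3P[_ + u]; rewrite /= -cat_rcons rcons_cat cat_path last_rcons.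
by case/andP=> ? ?; rewrite cat_rcons; split.
Qed.

Lemma rev_rcons_path x p y : path e x (rcons p y) -> path e y (rcons (rev p) x).
Proof.
have := rev_path e x (rcons p y).
rewrite last_rcons belast_rcons rev_cons => -> xpy.
by rewrite (eq_path (e' := e)) // => u v; rewrite e_sym.
Qed.

Lemma link_uniq B x q y c : link B x q y -> uniq c ->
  {in c, forall z, z \notin B} -> uniq (q ++ c).
Proof.
move=> [_ _ uq qB] uc cB; rewrite cat_uniq uq uc andbT.
by apply/hasPn => z /cB; apply: contra => /qB.
Qed.

(** The link [q] closes up with either arc of the cycle, and the two resulting cycles differ in
    length exactly as the arcs do. *)
Lemma ear_gap B x p y p' q : cyc (x :: p ++ y :: p') -> link B x q y ->
  {in x :: p ++ y :: p', forall z, z \notin B} ->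
  ~~ (0 < (size p - size p') + (size p' - size p) < 3).
Proof.
move=> /cyc_two_path[xpy ypx u] lq cB.
have uq := link_uniq lq u cB; have [q0 xqy _ _] := lq.
have {}q0 : 0 < size q by case: (q) q0.
have c1 : cyc (x :: p ++ y :: rev q).
  apply: two_path_cyc => //; first exact: rev_rcons_path.
    by uniq_by_count uq.
  by rewrite size_rev; lia.
have c2 : cyc (x :: q ++ y :: p').
  apply: two_path_cyc => //; last by lia.
  by uniq_by_count uq.
by have := cyc_gap c1 c2; rewrite /= !size_cat /= size_rev; lia.
Qed.
Lemma rot_head x c : x \in c -> exists i p, rot i c = x :: p.
Proof. by case/rot_to=> i p; exists i, p. Qed.

Lemma iter_next x p i : uniq (x :: p) -> i <= size p ->
  iter i (next (x :: p)) x = nth x (x :: p) i.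
Proof.
move=> u; elim: i => // i IHi ip; rewrite iterS IHi; last exact: ltnW.
have ip' : i < size (x :: p) by apply: leqW.
by rewrite next_nth mem_nth // index_uniq.
Qed.

Lemma iter_next_mem c i : {in c, forall z, iter i (next c) z \in c}.
Proof. by move=> z zc; elim: i => //= i; rewrite mem_next. Qed.

Lemma iter_next_inj c i : uniq c -> injective (iter i (next c)).
Proof.
move=> uc; elim: i => [|i IHi] x y //= /(can_inj (prev_next uc)); exact: IHi.
Qed.

Definition attached B z := 0 < deg_in B z.

(* A step of [s] along [c] cuts it into arcs of lengths [s] and [size c - s],
   which the hypothesis makes differ by one or two. *)
Lemma shift_not_attached B c s : cyc c -> connected B ->
  {in c, forall z, z \notin B} -> 0 < s < size c ->
  0 < (s.*2 - size c) + (size c - s.*2) < 3 ->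
  {in c, forall a, attached B a -> ~~ attached B (iter s (next c) a)}.
Proof.
move=> cc conB cB s_range s_half a ac Ba; apply/negP => Ba'.
have [i [p cE]] := rot_head ac.
have uc : uniq c by case/and3P: cc.
have szc : size c = (size p).+1 by rewrite -(size_rot i) cE.
have eq_next : next (a :: p) =1 next c by rewrite -cE; apply: next_rot.
have a'E : iter s (next c) a = nth a p s.-1.
  have uap : uniq (a :: p) by rewrite -cE rot_uniq.
  have sp : s <= size p by lia.
  by rewrite -(eq_iter eq_next) (iter_next uap sp); case: (s) s_range.
rewrite a'E in Ba'; have [q lq] := connected_link conB Ba Ba'.
have pE : a :: p = a :: take s.-1 p ++ nth a p s.-1 :: drop s p.
  have s1p : s.-1 < size p by lia.
  rewrite -{1}(cat_take_drop s.-1 p) (drop_nth a s1p).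
  by case: (s) s_range.
have := @ear_gap B a (take s.-1 p) (nth a p s.-1) (drop s p) q.
rewrite -pE -cE cyc_rot size_drop size_take => /(_ cc lq) gap.
have /gap : {in rot i c, forall z, z \notin B} by move=> z; rewrite mem_rot => /cB.
have s1p : s.-1 < size p by lia.
by rewrite s1p; lia.
Qed.

(** The step (n-1)/2, rounded down, cuts a cycle of length n into arcs whose lengths differ by one
    or two, so it maps attached vertices injectively to unattached ones. *)
Lemma card_attached_le B c : cyc c -> connected B ->
  {in c, forall z, z \notin B} ->
  #|[set z in c | attached B z]| <= #|[set z in c | ~~ attached B z]|.
Proof.
move=> cc conB cB; have c3 : 2 < size c by case/and3P: cc.
have uc : uniq c by case/and3P: cc.
have := @shift_not_attached B c (size c).-1./2 cc conB cB.
have -> : 0 < (size c).-1./2 < size c by lia.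
move=> /(_ isT) gap; rewrite -(card_imset _ (@iter_next_inj c (size c).-1./2 uc)).
apply: subset_leq_card; apply/subsetP => _ /imsetP[a + ->].
by rewrite !inE => /andP[ac Ba]; rewrite iter_next_mem //= gap //; lia.
Qed.

(** Equality makes the length n even, and the steps n/2 - 1 and n/2 + 1 both carry the attached set
    onto its complement in [c]. Hence the attached set is invariant under two steps, and two
    consecutive attached vertices would force all of [c] to be attached. *)
Lemma attached_alternate B c : cyc c -> connected B ->
  {in c, forall z, z \notin B} ->
  #|[set z in c | attached B z]| = #|[set z in c | ~~ attached B z]| ->
  ~~ odd (size c) /\ {in c, forall z, attached B (next c z) = ~~ attached B z}.
Proof.
move=> cc conB cB; set A := [set _ in _ | _]; set F := [set _ in _ | _] => AF.
have c3 : 2 < size c by case/and3P: cc.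
have uc : uniq c by case/and3P: cc.
have szc : size c = #|A| + #|F|.
  have := cardID (attached B) (mem c); rewrite (card_uniqP uc) => <-.
  by apply: f_equal2; apply: eq_card => z; rewrite !inE andbC.
have even_c : ~~ odd (size c) by rewrite szc AF addnn odd_double.
have evc := odd_double_half (size c); rewrite (negbTE even_c) add0n in evc.
have shiftF s : 0 < s < size c -> 0 < (s.*2 - size c) + (size c - s.*2) < 3 ->
    [set iter s (next c) a | a in A] = F.
  move=> s_range s_half; apply/eqP; rewrite eqEcard.
  rewrite (card_imset _ (@iter_next_inj c s uc)) AF leqnn andbT.
  apply/subsetP => _ /imsetP[a + ->]; rewrite !inE => /andP[ac Ba].
  by rewrite iter_next_mem //= (shift_not_attached cc conB cB s_range).
pose s := (size c)./2.-1.
have [sF s2F] : [set iter s (next c) a | a in A] = F /\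
                [set iter s.+2 (next c) a | a in A] = F.
  by split; apply: shiftF; rewrite /s; lia.
have next2 z : z \in A -> next c (next c z) \in A.
  move=> zA; have : iter s.+2 (next c) z \in F by rewrite -s2F imset_f.
  rewrite -addn2 iterD -sF => /imsetP[a aA].
  by move/(iter_next_inj uc)=> /= ->.
have next1 z : z \in A -> next c z \notin A.
  move=> zA; apply/negP => zA'.
  have allA i : (iter i (next c) z \in A) && (iter i.+1 (next c) z \in A).
    elim: i => [|i /andP[iA i1A]]; first by rewrite zA.
    by rewrite i1A; apply: next2.
  have : 0 < #|F| by rewrite -AF; apply/card_gt0P; exists z.
  move=> /card_gt0P[f]; rewrite -sF => /imsetP[a aA fE].
  have zc : z \in c by move: zA; rewrite inE => /andP[].
  have fc : f \in c by rewrite fE iter_next_mem //; move: aA; rewrite inE; case/andP.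
  have [i [p cE]] := rot_head zc.
  have : f \in z :: p by rewrite -cE mem_rot.
  move=> /(nthP z)[j jp fj].
  have : f \in A.
    have := allA j; rewrite -(eq_iter (_ : next (z :: p) =1 _)); last first.
      by rewrite -cE; apply: next_rot.
    by rewrite iter_next -?cE ?rot_uniq ?cE // fj => /andP[].
  have : f \in F by rewrite -sF fE imset_f.
  by rewrite !inE => /andP[_ /negbTE->]; rewrite andbF.
split=> // z zc.
have nextF : [set next c a | a in A] = F.
  apply/eqP; rewrite eqEcard (card_imset _ (can_inj (prev_next uc))) AF leqnn.
  rewrite andbT; apply/subsetP => _ /imsetP[a aA ->]; have := next1 a aA.
  by move: aA; rewrite !inE mem_next => /andP[-> _].
have [Bz|nBz] /= := boolP (attached B z).
  by have := next1 z; rewrite !inE mem_next zc Bz /= => /(_ isT)/negbTE.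
have : z \in F by rewrite inE zc.
rewrite -nextF => /imsetP[a aA ->].
by have := next2 a aA; rewrite inE => /andP[].
Qed.
Lemma alternate_nth B x p i : uniq (x :: p) ->
  {in x :: p, forall z, attached B (next (x :: p) z) = ~~ attached B z} ->
  i <= size p -> attached B (nth x (x :: p) i) = odd i (+) attached B x.
Proof.
move=> u alt ip; rewrite -(iter_next u ip); elim: i {ip} => //= i IHi.
by rewrite alt ?IHi ?iter_next_mem ?mem_head // addNb.
Qed.

(** * Rerouting a cycle through an ear *)

Section Ear.
Variables (B : {set V}) (f f' : V) (p1 p2 r : seq V).
Hypotheses (conB : connected B) (cc : cyc (f :: p1 ++ f' :: p2))
  (cB : {in f :: p1 ++ f' :: p2, forall z, z \notin B})
  (ff'r : path e f (rcons r f')) (ur : uniq (r ++ f :: p1 ++ f' :: p2))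
  (r0 : 0 < size r) (rB : {in r, forall z, z \notin B}).

(* The ear replaces the arc [p1]. *)
Lemma ear_gap0 : ~~ (0 < (size r - size p1) + (size p1 - size r) < 3).
Proof.
have [fp1f' f'p2f u] := cyc_two_path cc.
have c1 : cyc (f :: r ++ f' :: p2).
  apply: two_path_cyc => //; last by lia.
  by uniq_by_count ur.
by have := cyc_gap cc c1; rewrite /= !size_cat /=; lia.
Qed.

Lemma link_ear_uniq x q y : link B x q y ->
  uniq (q ++ r ++ f :: p1 ++ f' :: p2).
Proof.
move=> lq; apply: (link_uniq lq ur) => z.
by rewrite mem_cat => /orP[/rB|/cB].
Qed.

(* The ear, traversed from [y] back to [f] and on to [f'], replaces the arc
   from [y] to [f']. *)
Lemma ear_gap1 u y s x p : p1 = u ++ y :: s -> p2 = x :: p ->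
  attached B y -> attached B x ->
  ~~ (0 < (size r + 1 + size u - size s) + (size s - (size r + 1 + size u)) < 3).
Proof.
move=> p1E p2E By Bx; have [q lq] := connected_link conB Bx By.
have uq := link_ear_uniq lq; have [q0 xqy _ _] := lq.
have {}q0 : 0 < size q by case: (q) q0.
have [fp1f' f'p2f _] := cyc_two_path cc.
move: fp1f' f'p2f uq; rewrite p1E p2E rcons_cat cat_path /= rcons_path.
case/and4P=> fu uy ys sf' /andP[f'x _] uq.
have fuy : path e f (rcons u y) by rewrite rcons_path fu.
have c1 : cyc (y :: (s ++ [:: f']) ++ x :: q).
  apply: two_path_cyc => //; last by rewrite addn_gt0 q0 orbT.
    by rewrite cats1 rcons_path rcons_path ys sf' last_rcons.
  by uniq_by_count uq.
have c2 : cyc (f :: (r ++ f' :: x :: q) ++ y :: rev u).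
  apply: two_path_cyc; last by rewrite size_rev ?size_cat !addn_gt0 ?q0 ?r0 ?orbT.
  - rewrite rcons_cat -[rcons (f' :: _) y]/(f' :: x :: rcons q y).
    by rewrite -cat_rcons cat_path ff'r last_rcons /= f'x.
  - exact: rev_rcons_path.
  - by uniq_by_count uq.
by have := cyc_gap c1 c2; clear -q0 r0;
  rewrite /= ?size_cat /= ?size_cat /= ?size_rev; lia.
Qed.

(* The ear closes up the two outer pieces of the arc [p1]. *)
Lemma ear_gap2 u x s y w : p1 = u ++ x :: s ++ y :: w ->
  attached B x -> attached B y ->
  ~~ (0 < (size r + 2 + size u + size w - size s) +
          (size s - (size r + 2 + size u + size w)) < 3).
Proof.
move=> p1E Bx By; have [q lq] := connected_link conB Bx By.
have uq := link_ear_uniq lq; have [q0 xqy _ _] := lq.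
have {}q0 : 0 < size q by case: (q) q0.
have [fp1f' f'p2f _] := cyc_two_path cc.
move: fp1f' uq; rewrite p1E rcons_cat cat_path /= rcons_cat cat_path /=.
rewrite rcons_path => /and5P[fu ux xs sy /andP[yw wf']] uq.
have c1 : cyc (x :: s ++ y :: rev q).
  apply: two_path_cyc; last by rewrite size_rev ?size_cat !addn_gt0 ?q0 ?r0 ?orbT.
  - by rewrite rcons_path xs.
  - exact: rev_rcons_path.
  - by uniq_by_count uq.
have c2 : cyc (f :: (u ++ x :: q ++ y :: w) ++ f' :: rev r).
  apply: two_path_cyc; last by rewrite size_rev ?size_cat !addn_gt0 ?q0 ?r0 ?orbT.
  - rewrite rcons_path cat_path /= cat_path /= last_cat /= last_cat /= fu ux.
    by move: xqy; rewrite rcons_path => /andP[-> ->]; rewrite yw wf'.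
  - exact: rev_rcons_path.
  - by uniq_by_count uq.
have := cyc_gap c1 c2; clear -q0 r0.
by rewrite /= ?size_cat /= ?size_cat /= ?size_cat /= ?size_rev; lia.
Qed.

Lemma seq_split (s : seq V) d i : i < size s ->
  s = take i s ++ nth d s i :: drop i.+1 s.
Proof. by move=> i_s; rewrite -drop_nth // cat_take_drop. Qed.

(** Alternation makes the length of [p1] odd, with the attached vertices at its even indices. An ear
    with at most three inner vertices then violates one of the three gap lemmas. *)
Lemma alternating_ear_size :
  {in f :: p1 ++ f' :: p2, forall z, attached B (next (f :: p1 ++ f' :: p2) z)
     = ~~ attached B z} ->
  ~~ odd (size (f :: p1 ++ f' :: p2)) -> ~~ attached B f -> ~~ attached B f' ->
  3 < size r.
Proof.
move=> alt even_c nBf nBf'.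
have uc : uniq (f :: p1 ++ f' :: p2) by case/and3P: cc.
have attE i : i <= size (p1 ++ f' :: p2) ->
    attached B (nth f (f :: p1 ++ f' :: p2) i) = odd i.
  by move=> ic; rewrite (alternate_nth uc alt ic) (negbTE nBf) addbF.
have odd_p1 : odd (size p1).
  have := attE (size p1).+1; rewrite /= nth_cat ltnn subnn /= (negbTE nBf').
  by rewrite size_cat /= => /(_ _)/esym/negbFE; apply; lia.
have att1 i : i < size p1 -> ~~ odd i -> attached B (nth f p1 i).
  move=> ip1 oi; have := attE i.+1; rewrite /= nth_cat ip1 oi size_cat /=.
  by apply; lia.
have [x [p [p2E Bx]]] : exists x p, p2 = x :: p /\ attached B x.
  have := attE (size p1).+2; move: even_c; rewrite /= !size_cat /=.
  have p1n : ((size p1).+1 < size p1) = false by rewrite ltnNge leqnSn.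
  rewrite nth_cat p1n subSnn /= negbK odd_p1.
  case: (p2) => [|x p] /=; first by rewrite addn1 /= odd_p1.
  by move=> _ Bx; exists x, p; rewrite Bx //; lia.
have gap1 i : i < size p1 -> ~~ odd i ->
    ~~ (0 < (size r + 2 + 2 * i - size p1) + (size p1 - (size r + 2 + 2 * i)) < 3).
  move=> ip1 oi; have := ear_gap1 (seq_split f ip1) p2E (att1 i ip1 oi) Bx.
  by rewrite size_take ip1 size_drop; lia.
have gap2 i : 0 < i < size p1 -> ~~ odd i ->
    ~~ (0 < (size r + 2 + size p1 - 2 * i) +
            (2 * i - (size r + 2 + size p1)) < 3).
  case/andP=> i0 ip1 oi; have p10 : 0 < size p1 by lia.
  have p1E := seq_split f p10; rewrite take0 drop1 in p1E.
  have i1 : i.-1 < size (behead p1) by rewrite size_behead; lia.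
  rewrite (seq_split f i1) nth_behead prednK // in p1E.
  have := ear_gap2 p1E (att1 0 p10 isT) (att1 i ip1 oi).
  by rewrite size_take i1 size_drop size_behead /=; lia.
have gap0 := ear_gap0.
rewrite ltnNge; apply/negP => r3.
clear -gap0 gap1 gap2 r0 r3 odd_p1.
have [m mE] : exists m, size p1 = m.*2.+1.
  by exists (size p1)./2; rewrite -[LHS]odd_double_half odd_p1.
(* With [size p1] equal to 2m + 1, an even index close to m makes the two lengths differ by one or
   two. For m = 0 and ears with two or three inner vertices there is no such index, and replacing
   [p1] by the ear serves instead. *)
have {r3} r123 : [|| size r == 1, size r == 2 | size r == 3] by lia.
case/or3P: r123 => /eqP rE; rewrite mE rE in gap0 gap1 gap2.
- case: (boolP (odd m)) => om; [have := gap2 m.+1 | have := gap1 m]; lia.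
- case: (boolP (odd m)) => om; first by have := gap1 m.-1; lia.
  case: (posnP m) => m0; first by rewrite m0 in gap0.
  by have := gap1 m.-2; lia.
- case: (boolP (odd m)) => om; first by have := gap1 m.-1; lia.
  case: (posnP m) => m0; first by rewrite m0 in gap0.
  by have := gap2 m.+2; lia.
Qed.
End Ear.

(** * Degree sums in graphs that are almost forests *)

Lemma sum_bool_card S (P : pred V) :
  \sum_(v in S) (P v : nat) = #|[set v in S | P v]|.
Proof.
rewrite -sum1_card; under [RHS]eq_bigl do rewrite inE.
by rewrite big_mkcondr /=; apply: eq_bigr => w _; case: (P w).
Qed.

Lemma sum_squeeze S (F G : V -> nat) : {in S, forall v, F v <= G v} ->
  \sum_(v in S) G v <= \sum_(v in S) F v -> {in S, F =1 G}.
Proof.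
move=> FG sumGF v vS; move: sumGF; rewrite !(big_setD1 v vS) /= => sumGF.
have : \sum_(w in S :\ v) F w <= \sum_(w in S :\ v) G w.
  by apply: leq_sum => w /setD1P[_ /FG].
by have := FG v vS; lia.
Qed.

Lemma cyc_neighbours c x : cyc c -> x \in c ->
  [/\ e x (next c x), e x (prev c x) & next c x != prev c x].
Proof.
move=> cc xc; have [c3 ec uc] := and3P cc; split.
- exact: next_cycle.
- by rewrite e_sym; apply: prev_cycle.
have [i [p cE]] := rot_head xc.
have eq_next : next (x :: p) =1 next c by rewrite -cE; apply: next_rot.
have uxp : uniq (x :: p) by rewrite -cE rot_uniq.
have p2 : 1 < size p by rewrite -ltnS -[(size p).+1]/(size (x :: p)) -cE size_rot.
apply/eqP => /(congr1 (next c)); rewrite next_prev //.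
have := iter_next uxp p2; rewrite (eq_iter eq_next) /= => -> xE.
by case/andP: uxp; rewrite -{1}xE mem_nth.
Qed.

Lemma cyc_deg_in c x : cyc c -> x \in c -> 1 < deg_in [set z in c] x.
Proof.
move=> cc xc; have [en ep np] := cyc_neighbours cc xc; apply/deg_in_gt1P.
by exists (next c x), (prev c x); rewrite !inE mem_next mem_prev.
Qed.

(** Each forest [H :\ a] bounds the degree sum of [H] by 2 deg(a) + 2|H| - 4. The bounds for [a1]
    and [a2] are averaged, and every further vertex of [A] accounts for at least two. *)
Lemma forest_deg_sum (H A : {set V}) a1 a2 :
  A \subset H -> a1 \in A -> a2 \in A -> a1 != a2 ->
  {in A, forall a, acyclic (H :\ a)} -> {in A, forall a, 1 < deg_in H a} ->
  \sum_(v in H :\: A) deg_in H v <= 2 * #|H :\: A|.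
Proof.
move=> AH a1A a2A a12 acH degA.
have bound a b : a \in A -> b \in A -> a != b ->
    \sum_(v in H) deg_in H v + 4 <= 2 * deg_in H a + 2 * #|H|.
  move=> aA bA ab; have aH := subsetP AH a aA; rewrite (sum_deg_inD1 aH).
  have Ha0 : H :\ a != set0.
    by apply/set0Pn; exists b; rewrite !inE eq_sym ab (subsetP AH).
  by have := acyclic_deg_sum (acH a aA) Ha0; rewrite (cardsD1 a H) aH; lia.
have b1 := bound a1 a2 a1A a2A a12.
have b2 : \sum_(v in H) deg_in H v + 4 <= 2 * deg_in H a2 + 2 * #|H|.
  by apply: (bound a2 a1); rewrite // eq_sym.
have sumA : deg_in H a1 + deg_in H a2 + 2 * #|A :\ a1 :\ a2|
    <= \sum_(v in A) deg_in H v.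
  have a2A' : a2 \in A :\ a1 by rewrite !inE eq_sym a12.
  rewrite (big_setD1 a1) //= (big_setD1 a2) //= addnA leq_add2l mulnC.
  rewrite -sum_nat_const; apply: leq_sum => v; rewrite !inE => /and3P[_ _].
  exact: degA.
have cA : #|A| = #|A :\ a1 :\ a2| + 2.
  by rewrite (cardsD1 a1) a1A (cardsD1 a2 (A :\ a1)) !inE eq_sym a12 a2A; lia.
have cH : #|H| = #|A| + #|H :\: A|.
  by rewrite -(cardsID A H) (setIidPr AH).
move: b1 b2; rewrite (big_setID A) /= (setIidPr AH); lia.
Qed.

(* The last two clauses make the neighbours of [T] lose at least two edges, and
   be left with at most two, when [T] is deleted. *)
Definition core S T :=
  [&& T \subset [set v in S | deg_in S v == 2],
      [forall (t | t \in T), deg_in T t == 0] &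
      [forall (w | w \in S :\: T), attached T w ==>
         (1 < deg_in T w) && (deg_in S w <= deg_in T w + 2)]].

(* Cycles are chosen to avoid [T] and [rim S T]; the other neighbours of [T]
   keep exactly two of their neighbours when [T] is deleted. *)
Definition rim S T :=
  [set w in S :\: T | attached T w && (deg_in S w <= (deg_in T w).+1)].

(** * Counting edges around the core *)

Section Count.
Variables (S T B F : {set V}).
Hypotheses (deg2 : {in S, forall v, 1 < deg_in S v}) (coreT : core S T).
Let H := S :\: (B :|: T :|: rim S T).
Let T' := T :\: B.
Let R' := rim S T :\: B.
Let L := [set v in F | deg_in S v == 2].
Let N := [set v in F | attached T v].
Hypotheses (BS : B \subset S) (FH : F \subset H)
  (FB : {in F, forall v, deg_in B v = 0})
  (RB : {in R', forall v, deg_in B v = 0}).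

Lemma core_low : {in T, forall t, t \in S /\ deg_in S t = 2}.
Proof.
case/and3P: coreT => /subsetP sub _ _ t /sub; rewrite inE.
by case/andP=> -> /eqP.
Qed.

Lemma core_attached w : w \in S -> w \notin T -> attached T w ->
  1 < deg_in T w /\ deg_in S w <= deg_in T w + 2.
Proof.
case/and3P: coreT => _ _ /forall_inP h wS wT Tq; have := h w.
by rewrite inE wS wT => /(_ isT); rewrite Tq => /andP[].
Qed.

Lemma deg_in_parts v : deg_in S v =
  deg_in B v + deg_in H v + deg_in T' v + deg_in R' v.
Proof.
rewrite (deg_inID B S) (setIidPr BS) (deg_inID T (S :\: B)).
rewrite (deg_inID (rim S T) (S :\: B :\: T)).
have -> : (S :\: B) :&: T = T'.
  apply/setP=> x; rewrite !inE; case: (boolP (x \in T)); rewrite ?andbF ?andbT //.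
  by move=> /core_low[-> _]; rewrite andbT.
have -> : (S :\: B :\: T) :&: rim S T = R'.
  apply/setP=> x; rewrite !inE.
  by case: (x \in S); case: (x \in T); case: (x \in B).
have -> : S :\: B :\: T :\: rim S T = H by rewrite /H -!setDDl.
lia.
Qed.

Lemma deg_in_core v : deg_in B v = 0 -> deg_in T v = deg_in T' v.
Proof.
move=> B0; rewrite (deg_inID B T) -/T'.
by have := deg_in_sub v (subsetIr T B); rewrite B0; lia.
Qed.

(** A vertex not attached to [T] has its whole degree, at least two, in [H] and [R'], and the
    indicator helps out when it is exactly two. An attached one is off the rim, so two neighbours
    remain outside [T], and [attached T v] counts as the third. *)
Lemma F_deg : {in F, forall v,
  3 <= deg_in H v + deg_in R' v + (deg_in S v == 2) + attached T v}.
Proof.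
move=> v vF; have := subsetP FH v vF; rewrite !inE !negb_or.
case/andP=> /andP[/andP[vB vT] vR] vS; have := deg_in_parts v.
rewrite (FB vF) -(deg_in_core (FB vF)); have := deg2 vS.
have [Tv|] := boolP (attached T v); last by rewrite /attached; lia.
have [t1 t2] := core_attached vS vT Tv; move: vR.
by rewrite vT vS Tv /= -ltnNge; lia.
Qed.

Lemma N_R_deg : {in N :|: R', forall w, 1 < deg_in T' w}.
Proof.
move=> w /setUP[|wR].
  rewrite inE => /andP[wF Tq]; rewrite -deg_in_core; last exact: FB.
  have := subsetP FH w wF; rewrite !inE !negb_or.
  case/andP=> /andP[/andP[_ wT] _] wS.
  by have [] := core_attached wS wT Tq.
rewrite -(deg_in_core (RB wR)); move: wR; rewrite !inE.
case/and4P=> _ /andP[wT wS] Tq _.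
by have [] := core_attached wS wT Tq.
Qed.

Lemma R_deg : {in R', forall w, deg_in F w <= 1}.
Proof.
move=> w wR; have := deg_in_parts w.
have := deg_in_sub w FH; rewrite (RB wR) -(deg_in_core (RB wR)).
by move: wR; rewrite !inE => /and4P[_ _ _]; lia.
Qed.

Lemma T_deg : {in T', forall t, deg_in (N :|: R') t <= 2}.
Proof.
move=> t; rewrite inE => /andP[_ /core_low[_ <-]]; apply: deg_in_sub.
apply/subsetP=> w /setUP[].
  by rewrite inE => /andP[/(subsetP FH)]; rewrite inE => /andP[].
by rewrite !inE => /andP[_ /andP[/andP[]]].
Qed.

Lemma N_R_disjoint : #|N :|: R'| = #|N| + #|R'|.
Proof.
rewrite cardsU (_ : N :&: R' = set0) ?cards0 ?subn0 //.
apply/setP=> w; rewrite !inE; apply/negP=> /andP[/andP[/(subsetP FH)]].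
rewrite !inE => /andP[]; rewrite !negb_or => /andP[_ /negP nR] _ _.
by case/andP=> _ /nR.
Qed.

Lemma sum_T_le : 2 * (#|N| + #|R'|) <= \sum_(t in T') deg_in (N :|: R') t.
Proof.
rewrite sum_deg_in -N_R_disjoint mulnC -sum_nat_const.
exact: leq_sum N_R_deg.
Qed.

Lemma sum_R_le : \sum_(w in R') deg_in F w <= #|R'|.
Proof.
by rewrite -[leqRHS]muln1 -sum_nat_const; apply: leq_sum R_deg.
Qed.

Lemma sum_F_le : 3 * #|F| <= \sum_(v in F) deg_in H v +
  \sum_(w in R') deg_in F w + #|L| + #|N|.
Proof.
rewrite (sum_deg_in R' F) -!sum_bool_card -!big_split /= mulnC -sum_nat_const.
exact: leq_sum F_deg.
Qed.

(** Double counting of the edges between [T'] and [N :|: R']: at least two at each vertex of the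
    latter, at most two at each core vertex. *)
Lemma rim_card_le : #|N| + #|R'| <= #|T'|.
Proof.
have := sum_T_le; have : \sum_(t in T') deg_in (N :|: R') t <= 2 * #|T'|.
  by rewrite mulnC -sum_nat_const; apply: leq_sum T_deg.
lia.
Qed.

Lemma F_card_le :
  3 * #|F| <= \sum_(v in F) deg_in H v + #|L| + #|T'|.
Proof.
have := sum_F_le; have := sum_R_le; have := rim_card_le; lia.
Qed.

(** The two hypotheses close the chain of inequalities behind [F_card_le], so every termwise bound
    in it is attained. *)
Lemma tie_deg : #|L| + #|T'| <= #|F| ->
  \sum_(v in F) deg_in H v <= 2 * #|F| ->
  [/\ {in F, forall v,
        deg_in H v + deg_in R' v + (deg_in S v == 2) + attached T v = 3},
      {in R', forall w, deg_in F w = 1} &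
      {in T', forall t, deg_in (N :|: R') t = 2}].
Proof.
move=> tie sumH; have := sum_F_le; have := sum_R_le; have := sum_T_le.
have := rim_card_le => rimT sT sR sF; split.
- have h : \sum_(v in F) (deg_in H v + deg_in R' v + (deg_in S v == 2)
       + attached T v) <= \sum_(v in F) 3.
    rewrite !big_split /= !sum_bool_card -(sum_deg_in R' F) sum_nat_const.
    by rewrite -/L -/N; lia.
  by move=> v vF; rewrite -(sum_squeeze F_deg h vF).
- have h : \sum_(w in R') 1 <= \sum_(w in R') deg_in F w.
    by rewrite sum_nat_const; lia.
  exact: (sum_squeeze R_deg h).
- have h : \sum_(t in T') 2 <= \sum_(t in T') deg_in (N :|: R') t.
    by rewrite sum_nat_const; lia.
  exact: (sum_squeeze T_deg h).
Qed.
End Count.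

(** * A cycle and a maximal connected set disjoint from it *)

Lemma connected_exit W B x y : connected W -> x \in W -> x \in B -> y \in W ->
  y \notin B -> exists u v, [/\ u \in B, v \in W, v \notin B & e v u].
Proof.
move=> conW xW xB yW; have /connectP[p xp ->] := conW x y xW yW.
elim: p x xB {xW} xp => [|z p IHp] x xB /= => [_|/andP[/and3P[_ zW exz] zp] yB].
  by rewrite xB.
have [zB|zB] := boolP (z \in B); first exact: IHp zB zp yB.
by exists x, z; rewrite e_sym.
Qed.

(* [c] and [B] are chosen with [B] of maximal size; [A] is the set of feet of
   [B], and the maximality of [B] puts [A] on every cycle of [H]. *)
Section Bridge.
Variables (S T B : {set V}) (c : seq V).
Hypotheses (deg2 : {in S, forall v, 1 < deg_in S v})
  (con2 : {in S, forall x, connected (S :\ x)}) (coreT : core S T).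
Hypotheses (cc : cyc c) (conB : connected B) (B0 : B != set0) (BS : B \subset S).
Let H := S :\: (B :|: T :|: rim S T).
Hypotheses (cH : {subset c <= H})
  (maxB : forall B' c', B' \subset S -> connected B' -> B' != set0 -> cyc c' ->
    {subset c' <= S :\: (B' :|: T :|: rim S T)} -> #|B'| <= #|B|).
Let A := [set v in S :\: B | attached B v].
Let F := H :\: A.
Let T' := T :\: B.
Let R' := rim S T :\: B.
Let L := [set v in F | deg_in S v == 2].
Let N := [set v in F | attached T v].

(** A foot off [c'] could be added to [B], giving a larger connected set that still avoids [c']. *)
Lemma bridge_cycle c' : cyc c' -> {subset c' <= H} -> {in A, forall a, a \in c'}.
Proof.
move=> cc' c'H a; rewrite inE => /andP[/setDP[aS aB] Ba].
apply: contraTT isT => ac'.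
have := maxB (B' := a |: B) (c' := c').
rewrite cardsU1 aB ltnn; apply => //.
- by rewrite subUset sub1set aS.
- exact: connected_setU1.
- by apply/set0Pn; exists a; rewrite !inE eqxx.
- move=> z zc'; have := c'H z zc'.
  rewrite !in_setD !in_setU in_set1 !negb_or -!andbA => ->; rewrite andbT.
  by apply: contraNneq ac' => <-.
Qed.

Lemma subAc : {in A, forall a, a \in c}.
Proof. exact: bridge_cycle. Qed.

Lemma subAH : A \subset H.
Proof. by apply/subsetP => a /subAc /cH. Qed.

Lemma c_notB : {in c, forall z, z \notin B}.
Proof. by move=> z /cH; rewrite !inE !negb_or -!andbA => /andP[]. Qed.

(** [S :\ x] is connected and contains [B] together with another vertex of [c], so some edge leaves
    [B] without using [x]. *)
Lemma ex_attached_neq x : x \in c -> exists2 a, a \in A & a != x.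
Proof.
move=> xc; have xB := c_notB xc; have xS : x \in S by case/setDP: (cH xc).
have [b bB] := set0Pn _ B0.
have [y yc yx] : exists2 y, y \in c & y != x.
  case: (c) cc => [|y [|z p]] //= /and3P[_ _ /andP[+ _]].
  rewrite inE negb_or => /andP[yz _].
  have [<-|yx] := eqVneq y x; last by exists y; rewrite ?mem_head.
  by exists z; rewrite ?inE ?eqxx ?orbT // eq_sym.
have yH := cH yc; have yB := c_notB yc.
have [||||u [v [uB vS vB evu]]] :=
  connected_exit (x := b) (y := y) (B := B) (con2 xS).
- by rewrite !inE (subsetP BS) // andbT; apply: contraNneq xB => <-.
- by [].
- by move: yH; rewrite !inE yx => /andP[_ ->].
- by [].
move: vS; rewrite !inE => /andP[vx vS]; exists v => //.
by rewrite !inE vB vS; apply/deg_in_gt0P; exists u.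
Qed.

Lemma two_attached : exists a1 a2, [/\ a1 \in A, a2 \in A & a1 != a2].
Proof.
have [x xc] : exists x, x \in c.
  by case: (c) cc => [|x p] //; exists x; rewrite mem_head.
have [a1 a1A _] := ex_attached_neq xc.
have [a2 a2A a21] := ex_attached_neq (subAc a1A).
by exists a2, a1.
Qed.

Lemma FH : F \subset H.
Proof. exact: subsetDl. Qed.

Lemma mem_F v : v \in F -> [/\ v \in S, v \notin B, v \notin T & ~~ attached B v].
Proof.
rewrite !inE !negb_or -!andbA => /and5P[+ vB vT _ vS].
by rewrite vB vS /=.
Qed.

Lemma F_B0 : {in F, forall v, deg_in B v = 0}.
Proof. by move=> v /mem_F[_ _ _]; rewrite /attached -eqn0Ngt => /eqP. Qed.

Lemma R_B0 : {in R', forall v, deg_in B v = 0}.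
Proof.
move=> v /setDP[vR vB]; apply/eqP; rewrite eqn0Ngt; apply/negP => Bv.
have vS : v \in S by move: vR; rewrite !inE -!andbA; case/and4P.
have /subAc/cH : v \in A by rewrite !inE vB vS.
by rewrite inE in_setU vR orbT.
Qed.

Lemma F_acyclic : {in A, forall a, acyclic (H :\ a)}.
Proof.
move=> a aA c' cc' c'H; have /c'H : a \in c'.
  by apply: bridge_cycle aA => // z /c'H /setD1P[].
by rewrite !inE eqxx.
Qed.

Lemma c_deg_H : {in c, forall z, 1 < deg_in H z}.
Proof.
move=> z zc; apply: leq_trans (cyc_deg_in cc zc) _; apply: deg_in_sub.
by apply/subsetP=> y; rewrite inE => /cH.
Qed.

Lemma sum_F_H : \sum_(v in F) deg_in H v <= 2 * #|F|.
Proof.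
have [a1 [a2 [a1A a2A a12]]] := two_attached.
apply: forest_deg_sum subAH a1A a2A a12 F_acyclic _ => a /subAc; exact: c_deg_H.
Qed.

Lemma bridge_F_le : #|F| <= #|L| + #|T'|.
Proof.
have := F_card_le deg2 coreT BS FH F_B0 R_B0.
by have := sum_F_H; rewrite -/H -/L -/T'; lia.
Qed.

Lemma bridge_R_le : #|N| + #|R'| <= #|T'|.
Proof. exact: rim_card_le coreT BS FH F_B0 R_B0. Qed.

Lemma attached_cE : [set z in c | attached B z] = A.
Proof.
apply/setP=> z; rewrite !inE; apply/andP/andP => [[zc Bz]|[/andP[zB zS] Bz]].
  by have := cH zc; rewrite inE (c_notB zc) => /andP[_ ->].
by split=> //; apply: subAc; rewrite !inE zB zS.
Qed.

Lemma not_attached_sub : [set z in c | ~~ attached B z] \subset F.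
Proof.
apply/subsetP=> z; rewrite inE => /andP[zc Bz].
by rewrite inE (cH zc) inE (negbTE Bz) andbF.
Qed.

Lemma bridge_A_le : #|A| <= #|F|.
Proof.
rewrite -attached_cE; apply: leq_trans (card_attached_le cc conB c_notB) _.
exact: subset_leq_card not_attached_sub.
Qed.

(** A foot with a single neighbour in [B] costs one unit of defect when left out. A foot with two
    costs at most one when included, and a foot with more costs nothing. *)
Definition bridge_closure := B :|: [set a in A | 1 < deg_in B a].
Let U := bridge_closure.

Lemma deg_in_B_A b : b \in B -> deg_in S b = deg_in (B :|: A) b.
Proof.
move=> bB; rewrite (deg_inID (B :|: A)) [in X in _ + X]deg_in0 ?addn0.
  congr (deg_in _ b); apply/setIidPr.
  by rewrite subUset BS; apply/subsetP=> a; rewrite !inE -andbA => /and3P[].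
move=> w; rewrite !inE negb_or -!andbA => /and3P[wB + wS]; rewrite wB wS /=.
by apply: contraNF => ebw; apply/deg_in_gt0P; exists b; rewrite // e_sym.
Qed.

Lemma low_outside_le : #|L| + #|T'| <= \sum_(v in S :\: B) (3 - deg_in S v).
Proof.
have dLT : [disjoint L & T'].
  rewrite -setI_eq0; apply/eqP/setP=> z; rewrite !in_setI in_set0.
  apply/negP=> /andP[]; rewrite inE => /andP[/mem_F[_ _ zT _] _].
  by rewrite inE (negbTE zT) andbF.
have LTS : L :|: T' \subset S :\: B.
  apply/subsetP => z /setUP[].
    by rewrite inE => /andP[/mem_F[zS zB _ _] _]; rewrite inE zB.
  by rewrite !inE => /andP[-> /(core_low coreT)[->]].
have -> : #|L| + #|T'| = \sum_(v in L :|: T') 1.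
  by rewrite sum1_card cardsU (disjoint_setI0 dLT) cards0 subn0.
apply: leq_trans (_ : \sum_(v in L :|: T') (3 - deg_in S v) <= _).
  apply: leq_sum => z /setUP[]; first by rewrite inE => /andP[_ /eqP->].
  by rewrite inE => /andP[_ /(core_low coreT)[_ ->]].
by rewrite [leqRHS](big_setID (L :|: T')) /= (setIidPr LTS) leq_addr.
Qed.

(** Only feet with at most two neighbours in [B] cost anything, one each, while the part of
    [defect S] outside [B] is at least |L| + |T'|. As |A| <= |F| <= |L| + |T'|, the closure has no
    larger defect than [S]. *)
Lemma defect_closure :
  defect U + (#|L| + #|T'|) <= defect S + #|[set a in A | deg_in B a <= 2]|.
Proof.
pose A1 := [set a in A | deg_in B a == 1].
pose A' := [set a in A | 1 < deg_in B a].
have UB : U :&: B = B by apply/setIidPr; rewrite subsetUl.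
have UA : U :\: B = A'.
  apply/setP=> z; rewrite !inE; case: (z \in B) => //=.
have AE : B :|: A = U :|: A1.
  apply/setP=> z; rewrite !inE; case: (z \in B) => //=.
  case: (z \in S) => //=; rewrite /attached.
  by case: (deg_in B z) => [|[|n]].
have UA1 : [disjoint U & A1].
  rewrite -setI_eq0; apply/eqP/setP=> z; rewrite !inE.
  by case: (z \in B) => //=; case: (deg_in B z) => [|[|n]]; rewrite ?andbF.
have sumB : \sum_(b in B) (3 - deg_in U b) <= \sum_(b in B) (3 - deg_in S b) + #|A1|.
  have -> : #|A1| = \sum_(b in B) deg_in A1 b.
    rewrite -sum_deg_in -sum1_card; apply: eq_bigr => a.
    by rewrite inE => /andP[_ /eqP->].
  rewrite -big_split /=; apply: leq_sum => b bB.
  by rewrite (deg_in_B_A bB) AE deg_inU //; lia.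
have sumA : \sum_(a in A') (3 - deg_in U a) <= #|[set a in A' | deg_in B a == 2]|.
  rewrite -sum_bool_card; apply: leq_sum => a; rewrite inE => /andP[_].
  by have : deg_in B a <= deg_in U a := deg_in_sub a (subsetUl B A'); lia.
have cA2 : #|A1| + #|[set a in A' | deg_in B a == 2]|
    = #|[set a in A | deg_in B a <= 2]|.
  rewrite -[RHS](cardsID A1).
  congr (_ + _); apply: eq_card => a; rewrite !inE /attached.
    by case: (a \in B); case: (a \in S); case: (deg_in B a) => [|[|[|n]]].
  by case: (a \in B); case: (a \in S); case: (deg_in B a) => [|[|[|n]]].
have cLT := low_outside_le.
rewrite /defect (big_setID B) /= UB UA [X in _ <= X + _](big_setID B) /=.
rewrite (setIidPr BS); lia.
Qed.

Lemma closure_proper : U \proper S.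
Proof.
rewrite properE subUset BS /=; apply/andP; split.
  by apply/subsetP=> a; rewrite !inE -!andbA => /and4P[].
have [a [_ [aA _ _]]] := two_attached.
have : 0 < #|F| by apply: leq_trans bridge_A_le; apply/card_gt0P; exists a.
case/card_gt0P=> f fF; have [fS fB _ nBf] := mem_F fF.
apply/subsetPn; exists f => //; rewrite !inE negb_or fB /=.
by rewrite (negbTE nBf) andbF.
Qed.

(** What lies outside [B] is covered by [A], [F], [T'] and [R'], and each of these four sets has at
    most [defect S] members. *)
Lemma closure_card : #|S| <= #|U| + 4 * defect S.
Proof.
have cS : #|S| <= #|B| + #|H| + #|T'| + #|R'|.
  have sub : S \subset B :|: H :|: T' :|: R'.
    apply/subsetP=> z zS; rewrite !(in_setU, in_setD) zS.
    by case: (z \in B); case: (z \in T); case: (z \in rim S T).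
  apply: leq_trans (subset_leq_card sub) _.
  by do 3![apply: leq_trans (leq_card_setU _ _) _; rewrite leq_add2r].
have cHE : #|H| = #|A| + #|F| by rewrite -(cardsID A H) (setIidPr subAH).
have : #|B| <= #|U| := subset_leq_card (subsetUl B _).
have := bridge_A_le; have := bridge_R_le; have := bridge_F_le.
have := low_outside_le; rewrite /defect [X in 4 * X](big_setID B) /=; lia.
Qed.

(** * The case in which the defect does not drop *)

Section Tie.
Hypothesis tie : defect S <= defect U.

(** The tie forces equality in |A| <= |F| <= |L| + |T'| and in [defect_closure]. The unattached
    vertices of [c] number at least |A|, so they exhaust [F]. *)
Lemma tie_cards : [/\ #|A| = #|F|, #|F| = #|L| + #|T'|,
  [set z in c | ~~ attached B z] = F & {in A, forall a, deg_in B a <= 2}].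
Proof.
have := defect_closure; have := bridge_A_le; have := bridge_F_le => Fle Ale dU.
have sub : [set a in A | deg_in B a <= 2] \subset A.
  by apply/subsetP=> a; rewrite inE => /andP[].
have le2 := subset_leq_card sub.
have le3 := card_attached_le cc conB c_notB; rewrite attached_cE in le3.
have le4 := subset_leq_card not_attached_sub.
split; first by lia.
- by lia.
- by apply/eqP; rewrite eqEcard not_attached_sub; lia.
- have /eqP eqA : [set a in A | deg_in B a <= 2] == A by rewrite eqEcard sub; lia.
  by move=> a; rewrite -{1}eqA inE => /andP[].
Qed.

Lemma F_sub_c : {in F, forall f, f \in c}.
Proof. by have [_ _ <- _] := tie_cards => f; rewrite inE => /andP[]. Qed.

Lemma mem_cE z : z \in c -> (z \in F) = ~~ attached B z /\ (z \in A) = attached B z.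
Proof.
have [_ _ <- _] := tie_cards => zc; rewrite -attached_cE !inE zc.
by [].
Qed.

Lemma c_alternate : ~~ odd (size c) /\
  {in c, forall z, attached B (next c z) = ~~ attached B z}.
Proof.
apply: attached_alternate cc conB c_notB _.
by have [AF _ -> _] := tie_cards; rewrite attached_cE.
Qed.

Lemma prev_alternate : {in c, forall z, attached B (prev c z) = ~~ attached B z}.
Proof.
have uc : uniq c by case/and3P: cc.
move=> z zc; have [_ alt] := c_alternate.
by have := alt (prev c z); rewrite mem_prev next_prev // => ->; rewrite ?negbK.
Qed.

Lemma deg_A_F f : f \in F -> 1 < deg_in A f.
Proof.
move=> fF; have fc := F_sub_c fF; have [_ alt] := c_alternate.
have [en ep np] := cyc_neighbours cc fc.
have [_ _ _ nBf] := mem_F fF.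
apply/deg_in_gt1P; exists (next c f), (prev c f); split=> //.
  by rewrite (mem_cE _).2 ?mem_next // alt.
by rewrite (mem_cE _).2 ?mem_prev // prev_alternate.
Qed.

Lemma deg_F_A a : a \in A -> 1 < deg_in F a.
Proof.
move=> aA; have ac := subAc aA; have [_ alt] := c_alternate.
have [en ep np] := cyc_neighbours cc ac.
have Ba : attached B a by rewrite -(mem_cE ac).2.
apply/deg_in_gt1P; exists (next c a), (prev c a); split=> //.
  by rewrite (mem_cE _).1 ?mem_next // alt // Ba.
by rewrite (mem_cE _).1 ?mem_prev // prev_alternate // Ba.
Qed.

Lemma deg_H_AF v : deg_in H v = deg_in A v + deg_in F v.
Proof. by rewrite (deg_inID A H) (setIidPr subAH). Qed.

Lemma deg_H_F : {in F, forall f, deg_in H f = 2}.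
Proof.
move=> f fF; apply/esym/(sum_squeeze (F := fun=> 2) _ _ fF).
  by move=> v /F_sub_c; apply: c_deg_H.
by rewrite sum_nat_const mulnC sum_F_H.
Qed.

Lemma F_independent : {in F, forall f, deg_in F f = 0}.
Proof.
by move=> f fF; have := deg_H_F fF; have := deg_A_F fF; rewrite deg_H_AF; lia.
Qed.

(* Since every cycle of [H] contains [A], each member of [A] carries at least
   half of the degree sum of the chords; so there is no chord unless [#|A|] is
   two, when a chord cuts the four-cycle into triangles. *)
Lemma A_independent : {in A, forall a, deg_in A a = 0}.
Proof.
have [AF _ _ _] := tie_cards.
(* The edges between [A] and [F] number at most 2|F| = 2|A|, while each foot already has two of them
   on [c]. *)
have degF : {in A, forall a, deg_in F a = 2}.
  move=> a aA; apply/esym/(sum_squeeze (F := fun=> 2) _ _ aA).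
    by move=> v; apply: deg_F_A.
  rewrite sum_nat_const AF -sum_deg_in mulnC -[leqRHS]mulnC -sum_nat_const.
  by apply: leq_sum => f fF; rewrite -(deg_H_F fF) deg_H_AF leq_addr.
have sumH : \sum_(v in H) deg_in H v = \sum_(a in A) deg_in A a + 4 * #|F|.
  rewrite (big_setID A) /= (setIidPr subAH) -/F.
  under eq_bigr => a aA do rewrite deg_H_AF (degF a aA).
  rewrite [X in _ + X](eq_bigr (fun=> 2)); last by move=> f; apply: deg_H_F.
  by rewrite big_split /= !sum_nat_const; lia.
have cHE : #|H| = #|A| + #|F| by rewrite -(cardsID A H) (setIidPr subAH).
have [a1 [a2 [a1A a2A a12]]] := two_attached.
have half a : a \in A -> \sum_(v in A) deg_in A v <= 2 * deg_in A a.
  move=> aA; have aH := subsetP subAH a aA.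
  have Ha0 : H :\ a != set0.
    have [b bA ba] := ex_attached_neq (subAc aA).
    by apply/set0Pn; exists b; rewrite in_setD1 ba (subsetP subAH).
  have := acyclic_deg_sum (F_acyclic aA) Ha0; have := sum_deg_inD1 aH.
  rewrite sumH (cardsD1 a H) aH /= in cHE *.
  by rewrite deg_H_AF (degF a aA); clear -cHE AF; lia.
have : \sum_(a in A) \sum_(v in A) deg_in A v <= \sum_(a in A) 2 * deg_in A a.
  exact: leq_sum half.
rewrite sum_nat_const -big_distrr /= => halves.
have [A3|A2] := ltnP 2 #|A|.
  have /eqP : \sum_(v in A) deg_in A v = 0 by nia.
  by rewrite sum_nat_eq0 => /forall_inP h a /h /eqP.
move=> a aA; apply/eqP; rewrite eqn0Ngt; apply/negP => /deg_in_gt0P[b bA eab].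
have ab : a != b by apply: contraTneq eab => ->; rewrite e_irr.
have AE : A = [set a; b].
  apply/esym/eqP; rewrite eqEcard cards2 ab A2 andbT.
  by rewrite subUset !sub1set aA.
have [f fF] : exists f, f \in F.
  by apply/card_gt0P; rewrite -AF; apply/card_gt0P; exists a.
have [ac fc] := (subAc aA, F_sub_c fF).
have [f1 [f2 [f12 f1A f2A ef1 ef2]]] := deg_in_gt1P _ _ (deg_A_F fF).
have [efa efb] : e f a /\ e f b.
  move: f12 f1A f2A ef1 ef2; rewrite AE !inE => f12.
  by case/orP=> /eqP f1E /orP[]/eqP f2E; move: f12; rewrite f1E f2E ?eqxx.
have c3 : cyc [:: a; b; f].
  rewrite /cyc /= eab (e_sym b) efb efa /= !inE negb_or ab /= andbT.
  by apply/andP; split; apply: contraTneq fF => <-; rewrite inE ?aA ?bA.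
have := cyc_gap cc c3.
have uc : uniq c by case/and3P: cc.
have [_ _ cF _] := tie_cards.
have -> : size c = #|A| + #|F|.
  rewrite -(card_uniqP uc) -attached_cE -cF -(cardID (attached B) (mem c)).
  by apply: f_equal2; apply: eq_card => z; rewrite !inE andbC.
by rewrite -AF AE cards2 ab.
Qed.

(** With [T'] empty, [R'] is empty too and [L] is all of [F]. A foot then has neighbours only in
    [B], at most two, and in [F], at least two, as [core] demands. *)
Lemma tie_bigger_core : T' = set0 -> core S (T :|: F).
Proof.
move=> T'0; have [AF Fcard _ degA] := tie_cards.
have R'0 : R' = set0.
  by apply/eqP; rewrite -cards_eq0; have := bridge_R_le; rewrite T'0 cards0; lia.
have TB : T \subset B by rewrite -setD_eq0 -/T' T'0.
have LF : L = F.
  apply/eqP; rewrite eqEcard Fcard T'0 cards0 addn0 leqnn andbT.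
  by apply/subsetP=> v; rewrite inE => /andP[].
have Flow f : f \in F -> deg_in S f = 2.
  by rewrite -{1}LF inE => /andP[_ /eqP].
have dTF : [disjoint T & F].
  rewrite -setI_eq0; apply/eqP/setP=> v; rewrite in_setI in_set0.
  by apply/negP => /andP[vT /mem_F[_ _]]; rewrite vT.
have FT0 f : f \in F -> deg_in T f = 0.
  by move=> fF; have := deg_in_sub f TB; rewrite (F_B0 fF); case: (deg_in T f).
have BF0 b : b \in B -> deg_in F b = 0.
  move=> bB; apply: deg_in0 => f fF; apply: contraTF fF => ebf.
  apply/negP => /mem_F[_ _ _ /negP]; apply.
  by apply/deg_in_gt0P; exists b; rewrite // e_sym.
have [/subsetP Tlow /forall_inP indT _] := and3P coreT.
apply/and3P; split.
- apply/subsetP=> v /setUP[/Tlow//|vF].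
  by have [vS _ _ _] := mem_F vF; rewrite inE vS Flow.
- apply/forall_inP => v; rewrite deg_inU // => /setUP[vT|vF].
    by rewrite (eqP (indT v vT)) BF0 // (subsetP TB).
  by rewrite FT0 // F_independent.
- apply/forall_inP => w; rewrite in_setD in_setU negb_or => /andP[/andP[wT wF] wS].
  apply/implyP; rewrite /attached deg_inU // => TFw.
  have [wB|wB] := boolP (w \in B).
    rewrite BF0 // addn0 in TFw *.
    by have [-> ->] := core_attached coreT wS wT TFw.
  have wA : w \in A.
    apply: contraNT wF => wA; have : w \notin R' by rewrite R'0 inE.
    rewrite /R' in_setD wB /= => wR; rewrite /F in_setD wA /H in_setD !in_setU.
    by rewrite (negbTE wB) (negbTE wT) (negbTE wR) wS.
  have := deg_F_A wA; have := deg_in_parts coreT BS FH w.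
  rewrite -/H -/T' -/R' T'0 R'0 deg_H_AF (A_independent wA).
  have -> : deg_in set0 w = 0 by rewrite /deg_in big_set0.
  by move: (degA w wA); clear; lia.
Qed.

(** By the equalities of [tie_deg], [t] has two neighbours in [N :|: R']. One in [N] is itself in
    [F], and one in [R'] has a neighbour in [F]; this leads from [t] to [F] in two ways. *)
Lemma tie_ear t : t \in T' -> exists f f' r, [/\ f \in F, f' \in F, f != f',
  path e f (rcons r f') & [/\ uniq r, 0 < size r, size r <= 3 &
    {in r, forall z, z \notin c /\ z \notin B}]].
Proof.
move=> tT'; have [AF Fcard _ _] := tie_cards.
have [|F3 R1 T2] := tie_deg deg2 coreT BS FH F_B0 R_B0 _ sum_F_H.
  by rewrite -Fcard.
have offc z : z \in T' :|: R' -> z \notin c /\ z \notin B.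
  rewrite in_setU !in_setD => zTR; split; last by case/orP: zTR => /andP[].
  apply/negP => /cH; rewrite in_setD !in_setU !negb_or.
  case/andP=> /andP[/andP[_ /negbTE zT] /negbTE zR] _; move: zTR.
  by rewrite zT zR !andbF.
have tTR : t \in T' :|: R' by rewrite in_setU tT'.
have RT w : w \in R' -> w != t.
  by apply: contraTneq => ->; rewrite !inE; case/setDP: tT' => ->; rewrite andbF.
have anchor w : w \in R' -> exists2 f, f \in F & e w f.
  by move=> wR; apply/deg_in_gt0P; rewrite -/(deg_in F w) R1.
have NF w : w \in N -> w \in F /\ attached T w by rewrite inE => /andP[].
(* In the cases that involve [R'] this makes the two ends of the ear distinct. *)
have deg_R f : f \in F -> deg_in R' f + attached T f <= 1.
  by move=> fF; have := F3 f fF; rewrite (deg_H_F fF) -/R'; lia.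
have : 1 < deg_in (N :|: R') t by rewrite T2.
case/deg_in_gt1P=> w1 [w2 [w12 + + e1 e2]].
have mixed u w : u \in N -> w \in R' -> e t u -> e t w -> exists f r,
    [/\ f \in F, u != f, path e u (rcons r f) & [/\ uniq r, 0 < size r, size r <= 3 &
    {in r, forall z, z \notin c /\ z \notin B}]].
  move=> uN wR etu etw; have [f fF ewf] := anchor w wR.
  exists f, [:: t; w]; split=> //; last 1 first.
  - split=> //=; first by rewrite inE eq_sym RT.
    move=> z; rewrite !inE => /orP[]/eqP->; apply: offc => //.
    by rewrite in_setU wR orbT.
  - apply: contraTneq uN => uf; apply/negP => /NF[uF Tu].
    have := deg_R u uF; rewrite Tu addn1 ltnS leqn0 eqn0Ngt => /negP; apply.
    by apply/deg_in_gt0P; exists w; rewrite // e_sym uf.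
  - by rewrite /= e_sym etu etw ewf.
case/setUP=> [w1N|w1R] /setUP[w2N|w2R].
- exists w1, w2, [:: t]; have [[? _] [? _]] := (NF w1 w1N, NF w2 w2N).
  split=> //; first by rewrite /= e_sym e1 e2.
  by split=> // z; rewrite inE => /eqP->; apply: offc.
- have [f [r [fF w1f pr hr]]] := mixed w1 w2 w1N w2R e1 e2.
  by exists w1, f, r; have [? _] := NF w1 w1N; split.
- have [f [r [fF w2f pr hr]]] := mixed w2 w1 w2N w1R e2 e1.
  by exists w2, f, r; have [? _] := NF w2 w2N; split.
- have [f1 f1F ew1] := anchor w1 w1R; have [f2 f2F ew2] := anchor w2 w2R.
  exists f1, f2, [:: w1; t; w2]; split=> //.
  + apply: contraTneq f1F => f12; apply/negP => f1F.
    have := deg_R f1 f1F; rewrite leqNgt => /negP; apply.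
    apply: leq_trans (leq_addr _ _); apply/deg_in_gt1P; exists w1, w2.
    by split=> //; rewrite e_sym // f12.
  + by rewrite /= (e_sym f1) ew1 (e_sym w1) e1 e2 ew2.
  + split=> //=; first by rewrite !inE negb_or RT // w12 eq_sym RT.
    move=> z; rewrite !inE => /or3P[]/eqP->; apply: offc => //.
      by rewrite in_setU w1R orbT.
    by rewrite in_setU w2R orbT.
Qed.

(** A core vertex outside [B] would give an ear too short for [alternating_ear_size]. *)
Lemma tie_core_sub : T' = set0.
Proof.
apply/eqP; apply: contraT => /set0Pn[t /tie_ear].
case=> f [f' [r [fF f'F ff' pr [ur r0 r3 rcB]]]].
have [i [p cE]] := rot_head (F_sub_c fF); have uc : uniq c by case/and3P: cc.
have eq_next : next (f :: p) =1 next c by rewrite -cE; apply: next_rot.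
have mem_c : f :: p =i c by move=> z; rewrite -cE mem_rot.
have f'p : f' \in p.
  have := F_sub_c f'F; rewrite -mem_c in_cons eq_sym.
  by rewrite (negbTE ff').
have [p1 [p2 pE]] : exists p1 p2, p = p1 ++ f' :: p2.
  by case/splitPr: f'p => p1 p2; exists p1, p2.
have [even_c alt] := c_alternate.
have [_ _ _ nBf] := mem_F fF; have [_ _ _ nBf'] := mem_F f'F.
have cc' : cyc (f :: p) by rewrite -cE cyc_rot.
have cB' : {in f :: p, forall z, z \notin B} by move=> z; rewrite mem_c => /c_notB.
have ur' : uniq (r ++ f :: p).
  have [_ _ u] := and3P cc'; rewrite cat_uniq ur u andbT.
  by apply/hasPn => z; rewrite mem_c => zc; apply/negP => /rcB[]; rewrite zc.
have alt' : {in f :: p, forall z,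
    attached B (next (f :: p) z) = ~~ attached B z}.
  by move=> z; rewrite mem_c eq_next => /alt.
have even_c' : ~~ odd (size (f :: p)) by rewrite -cE size_rot.
have rB : {in r, forall z, z \notin B} by move=> z /rcB[].
rewrite pE in cc' cB' ur' alt' even_c'.
have := alternating_ear_size conB cc' cB' pr ur' r0 rB alt' even_c' nBf nBf'.
by rewrite ltnNge r3.
Qed.

Lemma tie_core_not_max : exists2 T2, core S T2 & #|T| < #|T2|.
Proof.
exists (T :|: F); first exact: tie_bigger_core tie_core_sub.
have [AF _ _ _] := tie_cards; have [a [_ [aA _ _]]] := two_attached.
have F0 : 0 < #|F| by rewrite -AF; apply/card_gt0P; exists a.
rewrite cardsU (_ : T :&: F = set0) ?cards0 ?subn0; first by lia.
apply/setP=> v; rewrite in_setI in_set0.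
by apply/negP => /andP[vT /mem_F[_ _]]; rewrite vT.
Qed.
End Tie.
End Bridge.
(* The truncated subtraction makes [size_bound k = k] for [k <= 2]. *)
Definition size_bound k := k + (k * (2 * k + 1) - 12).

(** * Arithmetic of the size bound *)

Lemma size_bound_ge k : k <= size_bound k.
Proof. exact: leq_addr. Qed.

Lemma size_bound_add k h : size_bound k + h <= size_bound (k + h).
Proof. rewrite /size_bound; nia. Qed.

Lemma size_bound_mono k l : k <= l -> size_bound k <= size_bound l.
Proof.
move=> kl; rewrite -(subnKC kl).
by apply: leq_trans (size_bound_add _ _); apply: leq_addr.
Qed.

Lemma size_bound3 k : 2 < k -> 3 * k <= size_bound k.
Proof. rewrite /size_bound; nia. Qed.

(** From three on, the bound is 2k^2 + 2k - 12, which grows by exactly 4k from k - 1 to k; this is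
    the loss in [closure_card]. *)
Lemma size_bound_step k l : 2 < l -> l < k -> size_bound l + 4 * k <= size_bound k.
Proof.
move=> l3 lk; have [m kE] : exists m, k = m.+4 by exists (k - 4); lia.
have lm : l <= m.+3 by lia.
apply: leq_trans (_ : size_bound m.+3 + 4 * k <= _).
  by rewrite leq_add2r size_bound_mono.
rewrite kE /size_bound; nia.
Qed.

(** The two sides of a cut vertex have total defect at most two above that of the whole; the added
    one stands for the cut vertex. *)
Lemma size_bound_cut a b k : 2 < a -> 2 < b -> a + b <= k + 2 ->
  size_bound a + size_bound b + 1 <= size_bound k.
Proof.
move=> a3 b3 abk.
apply: leq_trans (size_bound_mono (_ : a + b - 2 <= k)); last by lia.
have [[m aE] [n bE]] : (exists m, a = m + 3) /\ (exists n, b = n + 3).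
  by split; [exists (a - 3) | exists (b - 3)]; lia.
have -> : a + b - 2 = m + n + 4 by lia.
rewrite aE bE /size_bound; nia.
Qed.

(** A boolean form of containing a cycle, so that sets can be maximised subject to it. *)
Definition has_cycle W := [exists X : {set V}, [&& X \subset W, X != set0 &
  [forall (x | x \in X), 1 < deg_in X x]]].

Lemma has_cycleP W : reflect (exists2 c, cyc c & {subset c <= W}) (has_cycle W).
Proof.
apply: (iffP existsP) => [[X /and3P[/subsetP XW X0 /forall_inP degX]]|[c cc cW]].
  by have [c cc cX] := min_deg2_cycle X0 degX; exists c => // z /cX /XW.
exists [set z in c]; apply/and3P; split.
- by apply/subsetP=> z; rewrite inE => /cW.
- case: (c) cc => [|x p] // _; apply/set0Pn; exists x.
  by rewrite in_set mem_head.
- by apply/forall_inP => x; rewrite inE; apply: cyc_deg_in.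
Qed.

Definition connectedb B :=
  [forall (x | x \in B), [forall (y | y \in B), connect (edge_in B) x y]].

Lemma connectedP B : reflect (connected B) (connectedb B).
Proof.
apply: (iffP forall_inP) => [h x y xB yB|h x xB].
  by have /forall_inP := h x xB; apply.
by apply/forall_inP => y; apply: h.
Qed.

Lemma low_card_le S X : X \subset S -> {in X, forall v, deg_in S v = 2} ->
  #|X| <= defect S.
Proof.
move=> XS lowX; rewrite /defect (big_setID X) /= (setIidPr XS).
apply: leq_trans (leq_addr _ _); rewrite -sum1_card.
by apply: leq_sum => v /lowX->.
Qed.

(** * The induction step without cut vertices *)

Section Step.
Variable S : {set V}.
Hypotheses (S0 : S != set0) (deg2 : {in S, forall v, 1 < deg_in S v})
  (con2 : {in S, forall x, connected (S :\ x)}).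

(** The counting is applied with [B] empty and [F] equal to the forest [H]. If nonempty, [H] has at
    most [defect S - 2] vertices; [T] and the rim have at most [defect S] each. *)
Lemma forest_step T : core S T -> ~~ has_cycle (S :\: (T :|: rim S T)) ->
  2 < defect S /\ #|S| <= size_bound (defect S).
Proof.
move=> coreT noc; pose H := S :\: (set0 :|: T :|: rim S T).
have acH : acyclic H.
  move=> c cc cH; case/has_cycleP: noc; exists c => // z /cH.
  by rewrite /H set0U.
pose L := [set v in H | deg_in S v == 2].
have H0 : {in H, forall v, deg_in set0 v = 0}.
  by move=> v _; rewrite /deg_in big_set0.
have R0 : {in rim S T :\: set0, forall v, deg_in set0 v = 0}.
  by move=> v _; rewrite /deg_in big_set0.
have := F_card_le deg2 coreT (sub0set S) (subxx H) H0 R0.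
have := rim_card_le coreT (sub0set S) (subxx H) H0 R0.
rewrite -/H !setD0 -/L => Rle Hle.
have RT : #|rim S T| <= #|T| by apply: leq_trans Rle; apply: leq_addl.
have dLT : #|L :|: T| = #|L| + #|T|.
  rewrite cardsU (_ : L :&: T = set0) ?cards0 ?subn0 //.
  apply/setP=> v; rewrite !in_setI in_set0; apply/negP => /andP[].
  rewrite inE => /andP[+ _]; rewrite inE !in_setU !negb_or => /andP[+ _].
  by case/andP=> /andP[_ /negbTE->].
have LTle : #|L| + #|T| <= defect S.
  rewrite -dLT; apply: low_card_le.
    apply/subsetP=> v /setUP[|/(core_low coreT)[]//].
    by rewrite !inE => /andP[/andP[_ ->]].
  move=> v /setUP[|/(core_low coreT)[]//].
  by rewrite inE => /andP[_ /eqP].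
have cS : #|S| <= #|H| + #|T| + #|rim S T|.
  have sub : S \subset H :|: T :|: rim S T.
    apply/subsetP=> z zS; rewrite !(in_setU, in_setD, in_set0) zS /=.
    by case: (z \in T); case: (z \in rim S T).
  apply: leq_trans (subset_leq_card sub) _.
  by apply: leq_trans (leq_card_setU _ _) _; rewrite leq_add2r leq_card_setU.
have [HE|Hn0] := eqVneq H set0; last first.
  have := acyclic_deg_sum acH Hn0 => Hsum; have d3 : 2 < defect S by lia.
  by split=> //; have := size_bound3 d3; lia.
rewrite HE cards0 in cS.
have [d3|d2] := ltnP 2 (defect S).
  by split=> //; have := size_bound3 d3; lia.
(* Otherwise the graph is [K_4] minus an edge. *)
exfalso; have /set0Pn[t tT] : T != set0.
  by rewrite -cards_eq0; move: S0; rewrite -cards_eq0; lia.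
have [tS degt] := core_low coreT tT.
have [u1 [u2 [u12 u1S u2S e1 e2]]] : exists u1 u2,
    [/\ u1 != u2, u1 \in S, u2 \in S, e t u1 & e t u2].
  by apply/deg_in_gt1P; rewrite degt.
have SR v : v \in S -> v \notin T -> v \in rim S T.
  move=> vS vT; apply: contraT => vR; have : v \in H.
    by rewrite in_setD !in_setU in_set0 (negbTE vT) (negbTE vR).
  by rewrite HE in_set0.
have offT v : e t v -> v \notin T.
  move=> etv; have [_ /forall_inP ind _] := and3P coreT.
  apply: contraTN (ind t tT) => vT; rewrite -lt0n.
  by apply/deg_in_gt0P; exists v.
have T2 : #|T| <= 2 by apply: leq_trans d2; apply: leq_trans LTle; apply: leq_addl.
have dT2 v : v \in S -> e t v -> deg_in T v = 2 /\ #|T| = 2.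
  move=> vS etv; have Tv : attached T v.
    by apply/deg_in_gt0P; exists t; rewrite // e_sym.
  have [dv _] := core_attached coreT vS (offT v etv) Tv.
  have dle : deg_in T v <= #|T|.
    rewrite deg_inE; apply: subset_leq_card.
    by apply/subsetP=> w; rewrite inE; case/andP.
  have cT : #|T| = 2 by apply/eqP; rewrite eqn_leq T2 (leq_trans dv dle).
  by split=> //; apply/eqP; rewrite eqn_leq dv -cT dle.
have [du1 cT] := dT2 u1 u1S e1; have [du2 _] := dT2 u2 u2S e2.
have [t' t'T tt'] : exists2 t', t' \in T & t' != t.
  have : 0 < #|T :\ t| by move: cT; rewrite (cardsD1 t) tT add1n => -[->].
  by case/card_gt0P=> t' /setD1P[]; exists t'.
have TE : T = t' |: [set t].
  apply/esym/eqP; rewrite eqEcard cards2 tt' cT andbT.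
  by rewrite subUset !sub1set t'T.
have et' v : deg_in T v = 2 -> e v t'.
  rewrite TE /deg_in big_setU1 ?inE //= big_set1.
  by case: (e v t') => //; case: (e v t).
have u1T := offT u1 e1; have u2T := offT u2 e2.
have RE : rim S T = u1 |: [set u2].
  apply/esym/eqP; rewrite eqEcard cards2 u12 subUset !sub1set !SR //=.
  exact: leq_trans RT T2.
(* Otherwise [u1] would be a third vertex of degree two. *)
have u12e : e u1 u2.
  apply: contraT => nu12; have degu1 : deg_in S u1 = 2.
    rewrite (deg_inID T S) (_ : S :&: T = T) ?du1; last first.
      by apply/setIidPr; apply/subsetP=> v /(core_low coreT)[].
    rewrite [deg_in (S :\: T) _]deg_in0 // => w /setDP[wS wT].
    have := SR w wS wT; rewrite RE !inE => /orP[]/eqP->; first exact: e_irr.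
    exact/negbTE.
  have : #|u1 |: T| <= defect S.
    apply: low_card_le.
      by rewrite subUset sub1set u1S; apply/subsetP=> v /(core_low coreT)[].
    by move=> v /setU1P[->//|/(core_low coreT)[]].
  by rewrite cardsU1 u1T cT leqNgt ltnS d2.
have tq v : v \notin T -> (t != v) && (t' != v).
  by move=> vT; apply/andP; split; apply: contraNneq vT => <-.
have [tu1 t'u1] := andP (tq u1 u1T); have [tu2 t'u2] := andP (tq u2 u2T).
have c3 : cyc [:: t; u1; u2].
  by rewrite /cyc /= e1 u12e e_sym e2 !inE negb_or tu1 tu2 u12.
have c4 : cyc [:: t; u1; t'; u2].
  rewrite /cyc /= e1 (et' u1) // (e_sym t') (et' u2) // e_sym e2 !inE !negb_or.
  by rewrite tu1 tu2 u12 eq_sym tt' eq_sym t'u1 t'u2.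
by have := cyc_gap c3 c4.
Qed.

(* This covers the case in which no [B] can be chosen. *)
Lemma hamiltonian_step c : cyc c -> {subset c <= S} ->
  (forall c', cyc c' -> {subset c' <= S} -> {in S, forall v, v \in c'}) ->
  2 < defect S /\ #|S| <= size_bound (defect S).
Proof.
move=> cc cS ham; have S3 : 2 < #|S|.
  have /and3P[c3 _ uc] := cc; apply: leq_trans c3 _.
  by rewrite -(card_uniqP uc); apply: subset_leq_card; apply/subsetP.
have acS a : a \in S -> acyclic (S :\ a).
  move=> aS c' cc' c'S; have c'S' : {subset c' <= S} by move=> z /c'S /setD1P[].
  by have := c'S a (ham c' cc' c'S' a aS); rewrite !inE eqxx.
pose s := \sum_(v in S) deg_in S v.
have bound a : a \in S -> s + 4 <= 2 * deg_in S a + 2 * #|S|.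
  move=> aS; have Sa0 : S :\ a != set0.
    by rewrite -cards_eq0; move: S3; rewrite (cardsD1 a) aS; lia.
  have := acyclic_deg_sum (acS a aS) Sa0; have := sum_deg_inD1 aS.
  by rewrite -/s (cardsD1 a S) aS; lia.
(* With n = |S| > 2 this reads (n - 2)s <= 2n(n - 2). *)
have : \sum_(a in S) (s + 4) <= \sum_(a in S) (2 * deg_in S a + 2 * #|S|).
  exact: leq_sum bound.
rewrite sum_nat_const big_split /= sum_nat_const -big_distrr /= -/s => sle.
have {sle} s2 : s <= 2 * #|S| by nia.
have sd : 3 * #|S| <= s + defect S.
  rewrite /s /defect -big_split /= mulnC -sum_nat_const.
  by apply: leq_sum => v _; lia.
have Sd : #|S| <= defect S by lia.
by split; [lia | apply: leq_trans Sd (size_bound_ge _)].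
Qed.

Lemma two_connected_step :
  (forall U, U \proper S -> U != set0 ->
     2 < defect U /\ #|U| <= size_bound (defect U)) ->
  2 < defect S /\ #|S| <= size_bound (defect S).
Proof.
move=> IH.
have core0 : core S set0.
  apply/and3P; split; first exact: sub0set.
    by apply/forall_inP => v; rewrite inE.
  apply/forall_inP => w _; apply/implyP.
  by rewrite /attached /deg_in big_set0.
case: (@arg_maxnP {set V} set0 (core S) (fun T : {set V} => #|T|) core0).
move=> T coreT maxT.
have [hasc|/forest_step] := boolP (has_cycle (S :\: (T :|: rim S T))); last exact.
pose P B := [&& B \subset S, B != set0, connectedb B &
  has_cycle (S :\: (B :|: T :|: rim S T))].
have [/existsP[B1 PB1]|noB] := boolP [exists B, P B]; last first.
  (* A vertex missed by such a cycle would by itself be a candidate for [B]. *)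
  have full c : cyc c -> {subset c <= S :\: (T :|: rim S T)} ->
      {in S, forall v, v \in c}.
    move=> cc cS v vS; apply: contraNT noB => vc; apply/existsP; exists [set v].
    apply/and4P; split; first by rewrite sub1set.
    - by apply/set0Pn; exists v; rewrite inE.
    - by apply/connectedP; apply: connected1.
    - apply/has_cycleP; exists c => // z zc; have := cS z zc.
      rewrite !(in_setD, in_setU, in_set1) !negb_or => /andP[/andP[-> ->] ->].
      by rewrite !andbT; apply: contraNneq vc => <-.
  have [c cc cS] := has_cycleP _ hasc.
  have allc := full c cc cS.
  have MS v : v \in T :|: rim S T -> v \in S.
    by case/setUP=> [/(core_low coreT)[]//|]; rewrite !inE => /andP[/andP[]].
  (* A cycle that covers [S] and avoids [T] and its rim leaves both empty. *)
  have SE : S :\: (T :|: rim S T) = S.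
    apply/setP=> v; rewrite in_setD; have [vM|//] := boolP (v \in _ :|: _).
    by have := cS v (allc v (MS v vM)); rewrite in_setD vM.
  rewrite SE in cS full; exact: hamiltonian_step cc cS full.
case: (@arg_maxnP {set V} B1 P (fun B : {set V} => #|B|) PB1) => B.
case/and4P=> BS B0 /connectedP conB /has_cycleP[c cc cH] maxB.
have maxB' B' c' : B' \subset S -> connected B' -> B' != set0 -> cyc c' ->
    {subset c' <= S :\: (B' :|: T :|: rim S T)} -> #|B'| <= #|B|.
  move=> B'S conB' B'0 cc' c'S; apply: maxB; apply/and4P; split=> //.
    exact/connectedP.
  by apply/has_cycleP; exists c'.
pose U := bridge_closure S B.
have [|U3 Ule] := IH U (closure_proper con2 cc conB B0 BS cH maxB').
  have /set0Pn[b bB] := B0.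
  by apply/set0Pn; exists b; rewrite inE bB.
(* A tie contradicts the maximality of [T]; otherwise the defect of [U] is strictly smaller. *)
have [tie|lt] := leqP (defect S) (defect U).
  have [T2 coreT2] := tie_core_not_max deg2 con2 coreT cc conB B0 BS cH maxB' tie.
  by rewrite ltnNge => /negP[]; apply: maxT.
split; first by lia.
apply: leq_trans (closure_card deg2 con2 coreT cc conB B0 BS cH maxB') _.
by apply: leq_trans (size_bound_step U3 lt); rewrite leq_add2r.
Qed.
End Step.

(** * Deleting low vertices and splitting at cut vertices *)

Lemma sum_remove (phi : nat -> nat) S v : (forall n, phi n <= (phi n.+1).+1) ->
  v \in S -> \sum_(u in S :\ v) phi (deg_in (S :\ v) u) + phi (deg_in S v) <=
    \sum_(u in S) phi (deg_in S u) + deg_in S v.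
Proof.
move=> phiS vS; rewrite [X in _ <= X + _](big_setD1 v) //= addnC -addnA leq_add2l.
rewrite (deg_inD1 v vS) e_irr add0n [deg_in _ v]/deg_in -big_split /=.
(* Each neighbour of [v] loses one from its degree, so its term grows by at most one. *)
apply: leq_sum => u _; rewrite (deg_inD1 u vS) e_sym.
by case: (e v u); rewrite ?addn0 // addn1 add1n.
Qed.

(** If [x] has two neighbours in [Y] it is kept and costs at most one. Otherwise it is dropped, and
    at most one vertex of [Y] loses an edge. *)
Lemma cut_side S Y x : x \in S -> Y \subset S :\ x ->
  {in Y, forall w, deg_in S w = deg_in (x |: Y) w} ->
  exists Z, [/\ Y \subset Z, Z \subset x |: Y &
    defect Z <= \sum_(w in Y) (3 - deg_in S w) + 1].
Proof.
move=> xS YS degY; have xY : x \notin Y.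
  by apply/negP=> /(subsetP YS); rewrite !inE eqxx.
have degxY w : deg_in (x |: Y) w = e w x + deg_in Y w by rewrite /deg_in big_setU1.
have [d2|d1] := ltnP 1 (deg_in Y x).
  exists (x |: Y); rewrite subsetUr subxx /defect big_setU1 //=; split=> //.
  rewrite degxY e_irr add0n addnC leq_add //; last by lia.
  by apply: leq_sum => w /degY ->.
exists Y; rewrite subxx subsetUr /defect; split=> //.
apply: leq_trans (_ : \sum_(w in Y) ((3 - deg_in S w) + e x w) <= _).
  by apply: leq_sum => w wY; rewrite (degY w wY) degxY e_sym; lia.
by rewrite big_split /= leq_add2l.
Qed.

(** The two sides, each with or without [x], have total defect at most [defect S + 2]. Both defects
    exceed two, so that of [S] is at least four. *)
Lemma cut_step S x y z : x \in S -> y \in S :\ x -> z \in S :\ x ->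
  ~~ connect (edge_in (S :\ x)) y z ->
  (forall U, U \proper S -> U != set0 ->
     2 < defect U /\ #|U| <= size_bound (defect U)) ->
  2 < defect S /\ #|S| <= size_bound (defect S).
Proof.
move=> xS yS zS nyz IH.
pose Y := [set w in S :\ x | connect (edge_in (S :\ x)) y w].
pose Y' := (S :\ x) :\: Y.
have YS : Y \subset S :\ x by apply/subsetP=> w; rewrite inE => /andP[].
have Y'S : Y' \subset S :\ x by apply: subsetDl.
have sepY u v : u \in Y -> v \in Y' -> e u v = false.
  move=> uY /setDP[vS vY]; apply: contraNF vY => euv; rewrite inE vS /=.
  move: uY; rewrite inE => /andP[uS yu]; apply: connect_trans yu (connect1 _).
  by rewrite /= uS vS.
have SE : S = x |: (Y :|: Y').
  by rewrite -{1}(setD1K xS) -{1}(setID (S :\ x) Y) (setIidPr YS).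
have degY X X' : S = x |: (X :|: X') -> X \subset S :\ x ->
    (forall u v, u \in X -> v \in X' -> e u v = false) ->
    {in X, forall w, deg_in S w = deg_in (x |: X) w}.
  move=> SX XS sep w wX; rewrite (deg_inID (x |: X) S) [in X in _ + X]deg_in0.
    rewrite addn0; congr (deg_in _ w); apply/setIidPr.
    by rewrite subUset sub1set xS (subset_trans XS) // subD1set.
  move=> v; rewrite {1}SX !inE negb_or -!andbA => /and3P[/negbTE-> /negbTE-> /=].
  exact: sep.
have [Z [YZ ZY Zd]] := cut_side xS YS (degY Y Y' SE YS sepY).
have SE' : S = x |: (Y' :|: Y) by rewrite (setUC Y').
have [|Z' [YZ' ZY' Zd']] := cut_side xS Y'S (degY Y' Y SE' Y'S _).
  by move=> u v uY' vY; rewrite e_sym sepY.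
have yY : y \in Y by rewrite inE yS connect0.
have zY' : z \in Y' by rewrite in_setD zS inE zS (negbTE nyz).
have proper_side X X' v : X' \subset x |: X -> X \subset S :\ x -> v \in S :\ x ->
    v \notin X -> X' \proper S.
  move=> X'X XS /setD1P[vx vS] vX; rewrite properE; apply/andP; split.
    apply: subset_trans X'X _.
    by rewrite subUset sub1set xS (subset_trans XS) // subD1set.
  apply/subsetPn; exists v => //; apply: contra vX => /(subsetP X'X).
  by rewrite in_setU1 (negbTE vx).
have [||Z3 Zle] := IH Z.
- by apply: proper_side ZY YS zS _; move: zY'; rewrite in_setD => /andP[].
- by apply/set0Pn; exists y; apply: subsetP yY.
have [||Z'3 Z'le] := IH Z'.
- by apply: proper_side ZY' Y'S yS _; rewrite in_setD yY.
- by apply/set0Pn; exists z; apply: subsetP zY'.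
have sumS : \sum_(w in Y) (3 - deg_in S w) + \sum_(w in Y') (3 - deg_in S w)
    <= defect S.
  rewrite /defect [leqRHS](big_setD1 x xS) /= [X in _ <= _ + X](big_setID Y) /=.
  by rewrite (setIidPr YS) leq_addl.
have dZ : defect Z + defect Z' <= defect S + 2 by clear -Zd Zd' sumS; lia.
split; first by clear -dZ Z3 Z'3; lia.
have cS : #|S| = #|Y| + #|Y'| + 1.
  by rewrite (cardsD1 x) xS -(cardsID Y (S :\ x)) (setIidPr YS) addnC.
have := size_bound_cut Z3 Z'3 dZ.
move: (subset_leq_card YZ) (subset_leq_card YZ'); clear -cS Zle Z'le; lia.
Qed.

(** The two claims are proved together, because [size_bound_step] and [size_bound_cut] apply only to
    parts of defect above two. *)
Lemma no_near_cycles_bound S : (defect S <= 2 -> S = set0) /\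
  #|S| <= size_bound (low_count S) + shortfall S.
Proof.
have [n] := ubnP #|S|; elim: n S => // n IHn S leSn.
have [->|S0] := eqVneq S set0; first by rewrite cards0.
have [/exists_inP[v vS dv]|] := boolP [exists (v | v \in S), deg_in S v <= 1].
  have cS : #|S| = #|S :\ v|.+1 by rewrite (cardsD1 v) vS.
  have [|IH0 IHle] := IHn (S :\ v); first by rewrite -ltnS -cS.
  have d3 : defect (S :\ v) + (3 - deg_in S v) <= defect S + deg_in S v.
    by apply: (@sum_remove (fun n => 3 - n)) => // m; lia.
  have d2 : shortfall (S :\ v) + (2 - deg_in S v) <= shortfall S + deg_in S v.
    by apply: (@sum_remove (fun n => 2 - n)) => // m; lia.
  have d1 : low_count (S :\ v) + (deg_in S v < 3) <= low_count S + deg_in S v.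
    by apply: (@sum_remove (fun n => n < 3)) => // m; lia.
  (* An isolated [v] alone would give defect three, so [v] has a neighbour, yet [S :\ v] is empty by
     induction. *)
  split=> [dS|].
    have dv1 : 0 < deg_in S v by lia.
    have Sv0 : S :\ v = set0 by apply: IH0; lia.
    by move: dv1; rewrite (deg_inD1 v vS) e_irr Sv0 /deg_in big_set0.
  rewrite cS; have dlt : low_count (S :\ v) + shortfall (S :\ v)
      < low_count S + shortfall S by rewrite -!defectE; lia.
  have lt3 : (deg_in S v < 3) = true by lia.
  rewrite lt3 in d1.
  (* Neither [low_count] nor [shortfall] rises and their sum drops, so one of them pays for [v]. *)
  have [hlt|hge] := ltnP (shortfall (S :\ v)) (shortfall S).
    have : size_bound (low_count (S :\ v)) <= size_bound (low_count S).
      by apply: size_bound_mono; lia.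
    lia.
  have : size_bound (low_count (S :\ v) + 1) <= size_bound (low_count S).
    by apply: size_bound_mono; lia.
  by have := size_bound_add (low_count (S :\ v)) 1; lia.
rewrite negb_exists_in => /forall_inP deg2'.
have deg2 : {in S, forall v, 1 < deg_in S v} by move=> v /deg2'; rewrite -ltnNge.
have IH U : U \proper S -> U != set0 ->
    2 < defect U /\ #|U| <= size_bound (defect U).
  move=> US U0; have [|U2 Ule] := IHn U.
    exact: leq_trans (proper_card US) leSn.
  split; first by rewrite ltnNge; apply: contra U0 => /U2 ->.
  by apply: leq_trans Ule _; rewrite defectE size_bound_add.
suff [d3 le] : 2 < defect S /\ #|S| <= size_bound (defect S).
  split=> [|{d3}]; first by rewrite leqNgt d3.
  apply: leq_trans le _; have h0 : shortfall S = 0.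
    by apply: big1 => v /deg2; case: (deg_in S v) => [|[]].
  by rewrite defectE h0 !addn0.
have [/forall_inP con2|] := boolP [forall (x | x \in S), connectedb (S :\ x)].
  by apply: two_connected_step => // x xS; apply/connectedP/con2.
rewrite negb_forall_in => /exists_inP[x xS].
rewrite negb_forall_in => /exists_inP[y yS].
rewrite negb_forall_in => /exists_inP[z zS nyz].
exact: cut_step xS yS zS nyz IH.
Qed.

End Graph.

(** * Translation to the notions of the theorem *)

Theorem mainTheorem1 (k : nat) (V : finType) (e : rel V)
    (G_simple : simple_graph e) (V_nonempty : 0 < #|V|)
    (G_low : #|[set v | degree e v < 3]| <= k)
    (G_large : 5 * k ^ 2 <= #|V|) :
  exists c1 c2 : seq V,
    [/\ is_cycle e c1, is_cycle e c2
      & `|cycle_length c1 - cycle_length c2|%N \in [:: 1; 2]].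
Proof.
have [e_sym e_irr] := G_simple.
have degE v : degree e v = deg_in e setT v.
  rewrite degreeE // deg_inE.
  by apply: eq_card => w; rewrite !inE.
have lowE : low_count e setT <= k.
  apply: leq_trans G_low; rewrite /low_count sum_bool_card.
  by apply: subset_leq_card; apply/subsetP => v; rewrite !inE degE.
(* The existence of a cycle of given length is made boolean, which allows the argument by
   contradiction. *)
pose len n := [exists t : n.-tuple V, cyc e t].
have lenP c : cyc e c -> len (size c).
  by move=> cc; apply/existsP; exists (in_tuple c).
have [/existsP[n /orP[]/andP[/existsP[c1 cc1] /existsP[c2 cc2]]]|none] :=
    boolP [exists n : 'I_#|V|.+1,
      (len n && len n.+1) || (len n && len n.+2)].
- exists c1, c2; split=> //.
  rewrite (cycle_lengthE cc1) (cycle_lengthE cc2) !size_tuple !inE.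
  by apply/orP; left; lia.
- exists c1, c2; split=> //.
  rewrite (cycle_lengthE cc1) (cycle_lengthE cc2) !size_tuple !inE.
  by apply/orP; right; lia.
exfalso; have nonear c1 c2 : cyc e c1 -> cyc e c2 ->
    size c2 \notin [:: (size c1).+1; (size c1).+2].
  move=> cc1 cc2; apply: contra none => near; apply/existsP.
  have c1V : size c1 < #|V|.+1.
    by have /and3P[_ _ uc1] := cc1; rewrite -(card_uniqP uc1) ltnS max_card.
  exists (Ordinal c1V); rewrite /= lenP //=.
  by move: near; rewrite !inE => /orP[]/eqP <-; rewrite lenP ?orbT.
have [bv le] := no_near_cycles_bound e_sym e_irr nonear setT.
have short := shortfall_le e setT; rewrite cardsT in le.
(* For [k = 0] the defect vanishes, so the graph would be empty. For [k > 0] the shortfall is at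
   most 2k, and [size_bound k + 2 * k] is less than 5k^2. *)
have := size_bound_mono lowE; case: (posnP k) => [k0|k_gt0].
  move: lowE; rewrite k0 leqn0 => /eqP low0 _.
  have VE : [set: V] = set0 by apply: bv; rewrite defectE low0; lia.
  by move: V_nonempty; rewrite -cardsT VE cards0.
rewrite expnS expn1 in G_large.
rewrite {2}/size_bound; nia.
Qed.
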